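(* Let $\mathcal{A}$ be a unital $C^*$-algebra and $\mathcal{H}$ a complex Hilbert space with $\dim(\mathcal{H})<\infty$. Then $\mathrm{CCP}(\mathcal{A},\mathscr{B}(\mathcal{H}))$ equals the closure, in the BW-topology on $\mathrm{CP}(\mathcal{A},\mathscr{B}(\mathcal{H}))$, of the $C^*$-convex hull of the set of $C^*$-extreme points of $\mathrm{CCP}(\mathcal{A},\mathscr{B}(\mathcal{H}))$.
   Context: $\mathscr{B}(\mathcal{H})$ is the algebra of bounded linear operators on $\mathcal{H}$; $1$ is the unit of $\mathcal{A}$, $I$ the identity operator. ''CP'' means completely positive (linear); $\mathrm{CP}(\mathcal{A},\mathscr{B}(\mathcal{H}))$ is the set of all CP maps $\mathcal{A}\to\mathscr{B}(\mathcal{H})$. For $T\in\mathscr{B}(\mathcal{H})$, $\mathrm{Ad}_T(X):=T^*XT$. $\mathrm{CCP}(\mathcal{A},\mathscr{B}(\mathcal{H}))$ is the set of all contractive CP maps $\Phi:\mathcal{A}\to\mathscr{B}(\mathcal{H})$ (equivalently CP maps with $\Phi(1)\leq I$). A map $\Phi\in\mathrm{CCP}(\mathcal{A},\mathscr{B}(\mathcal{H}))$ is a $C^*$-extreme point of it if whenever $\Phi=\sum_{j=1}^n\mathrm{Ad}_{T_j}\circ\Phi_j$ with $\Phi_j\in\mathrm{CCP}(\mathcal{A},\mathscr{B}(\mathcal{H}))$ and $T_j\in\mathscr{B}(\mathcal{H})$ invertible with $\sum_{j=1}^nT_j^*T_j=I$, there exist unitaries $U_j\in\mathscr{B}(\mathcal{H})$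 with $\Phi_j=\mathrm{Ad}_{U_j}\circ\Phi$ for all $j$. For $\mathcal{S}\subseteq\mathrm{CP}(\mathcal{A},\mathscr{B}(\mathcal{H}))$, its $C^*$-convex hull is the set of all $\sum_{j=1}^n\mathrm{Ad}_{T_j}\circ\Phi_j$ with $n\geq1$, $\Phi_j\in\mathcal{S}$, and $T_j\in\mathscr{B}(\mathcal{H})$ (not necessarily invertible) satisfying $\sum_{j=1}^nT_j^*T_j=I$. The BW (bounded-weak) topology is the usual weak* topology on the space of bounded linear maps $\mathcal{A}\to\mathscr{B}(\mathcal{H})$; on norm-bounded sets (such as $\mathrm{CCP}(\mathcal{A},\mathscr{B}(\mathcal{H}))$) a net $\Phi_\alpha$ converges to $\Phi$ in it iff $\Phi_\alpha(a)\to\Phi(a)$ in the weak operator topology for every $a\in\mathcal{A}$. *)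

(* Defs.v *)
From HB Require Import structures.
From mathcomp Require Import all_boot all_order all_algebra.
From mathcomp Require Import complex.
From mathcomp Require Import all_classical all_reals all_analysis.

Set Implicit Arguments.
Unset Strict Implicit.
Unset Printing Implicit Defensive.

Import Order.TTheory GRing.Theory Num.Theory.
Import numFieldNormedType.Exports.

Local Open Scope classical_set_scope.
Local Open Scope ring_scope.

(* The norm takes its values in R[i], as it does for normed modules over a
   [numFieldType]; the axioms make them real and nonnegative. It is part of the
   mixin because no structure can inherit from both [GRing.Algebra] and
   [CompleteNormedModule] (missing join below [Num.NumDomain]). *)
HB.mixin Record isCStarAlgebra (R : realType) (A : Type)
    of GRing.Algebra R[i] A := {
  cnorm : A -> R[i] ;
  star : A -> A ;
  cnorm0_eq0 : forall x : A, cnorm x = 0 -> x = 0 ;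
  ler_cnormD : forall x y : A, cnorm (x + y) <= cnorm x + cnorm y ;
  cnormZ : forall (c : R[i]) (x : A), cnorm (c *: x) = `|c| * cnorm x ;
  ler_cnormM : forall x y : A, cnorm (x * y) <= cnorm x * cnorm y ;
  cnorm_complete : forall u : nat -> A,
    (forall e : R[i], 0 < e -> exists N : nat, forall m n : nat,
       (N <= m)%N -> (N <= n)%N -> cnorm (u m - u n) < e) ->
    exists l : A, forall e : R[i], 0 < e -> exists N : nat, forall n : nat,
      (N <= n)%N -> cnorm (u n - l) < e ;
  starK : involutive star ;
  starD : {morph star : x y / x + y} ;
  starZ : forall (c : R[i]) (x : A), star (c *: x) = c^* *: star x ;
  starM : forall x y : A, star (x * y) = star y * star x ;
  cnorm_starM : forall x : A, cnorm (star x * x) = cnorm x ^+ 2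
}.

#[short(type="cstarAlgType")]
HB.structure Definition CStarAlgebra (R : realType) :=
  { A of GRing.Algebra R[i] A & isCStarAlgebra R A }.

(* A finite-dimensional complex Hilbert space is a [vectType R[i]] together
   with an inner product, linear in its first argument; such a space is complete
   and all its linear operators are bounded, so B(H) is ['End(H)]. *)
Section Operators.
Variables (R : realType) (H : vectType R[i]) (dot : {dot H for @Num.conj R[i]}).
Implicit Types (T X : 'End(H)) (h k : H).

Definition hnorm h : R[i] := sqrtC (dot h h).

(* The unique S with <T h, k> = <h, S k>; see [adjP]. *)
Definition adj T : 'End(H) :=
  xget 0 [set S : 'End(H) | forall h k, dot (T h) k = dot h (S k)].

Definition Ad T X : 'End(H) := (adj T \o X \o T)%VF.

Definition op_invertible T : Prop :=
  exists S : 'End(H), (S \o T)%VF = \1%VF /\ (T \o S)%VF = \1%VF.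

Definition op_unitary T : Prop :=
  (adj T \o T)%VF = \1%VF /\ (T \o adj T)%VF = \1%VF.

(* Positivity of an n x n operator matrix, seen as an operator on H^n. *)
Definition opmx_pos n (M : 'M['End(H)]_n) : Prop :=
  forall h : 'I_n -> H, 0 <= \sum_(i < n) \sum_(j < n) dot (M i j (h j)) (h i).

Lemma dot_injr h k : (forall u, dot u h = dot u k) -> h = k.
Proof.
move=> e; apply/eqP; rewrite -subr_eq0 -(dnorm_eq0 dot).
by rewrite linearBr /= e subrr.
Qed.

Lemma riesz (f : {linear H -> R[i]^o}) : exists k, forall h, f h = dot h k.
Proof.
pose n := \dim {:H}; pose b := vbasis {:H}.
have bP h : h = \sum_(i < n) coord b i h *: b`_i.
  by rewrite {1}(coord_vbasis (memvf h)).
pose G : 'M[R[i]]_n := \matrix_(i, j) dot b`_i b`_j.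
have GE (i j : 'I_n) : G i j = dot b`_i b`_j by rewrite mxE.
have Gu : G \in unitmx.
  rewrite -row_free_unit -kermx_eq0; apply/eqP/row_matrixP => i.
  rewrite row0; set u := row i _.
  have uG : u *m G = 0.
    by rewrite /u -row_mul mulmx_ker row0.
  pose h := \sum_(j < n) u 0 j *: b`_j.
  have h0 : h = 0.
    apply/eqP; rewrite -(dnorm_eq0 dot).
    apply/eqP; rewrite {2}(bP h) linear_sumr big1 //= => j _.
    rewrite linearZr_LR /= [X in _ * X](_ : _ = 0) ?mulr0 //.
    have := congr1 (fun M : 'rV_n => M 0 j) uG; rewrite !mxE => uGj.
    rewrite /h linear_sumlz -[RHS]uGj; apply: eq_bigr => k _.
    by rewrite linearZl_LR /= GE.
  have /freeP bfree := basis_free (vbasisP {:H}).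
  by apply/matrixP => i' j; rewrite ord1 [RHS]mxE; apply: bfree.
pose c := invmx G *m (\col_i (f b`_i)).
have Gc (i : 'I_n) : f b`_i = \sum_j G i j * c j 0.
  have : G *m c = \col_i (f b`_i) by rewrite /c mulKVmx.
  by move=> /(congr1 (fun M : 'cV_n => M i 0)); rewrite !mxE.
exists (\sum_j (c j 0)^* *: b`_j) => h.
rewrite {1 2}(bP h) linear_sum linear_sumlz; apply: eq_bigr => i _.
rewrite linearZ linearZl_LR /= Gc linear_sumr; congr (_ * _).
by apply: eq_bigr => j _; rewrite linearZr_LR /= conjCK GE mulrC.
Qed.

Lemma adjP T h k : dot (T h) k = dot h (adj T k).
Proof.
suff [S SP] : exists S : 'End(H), forall h k, dot (T h) k = dot h (S k).
  by rewrite /adj; case: xgetP => [S' _ ->|/(_ S)].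
have ex v : exists w, forall u, dot (T u) v = dot u w.
  have lf : linear (fun u => dot (T u) v : R[i]^o).
    by move=> a x y; rewrite linearP linearPl.
  pose m := GRing.isLinear.Build _ _ _ _ _ lf.
  pose F : {linear H -> R[i]^o} := HB.pack (fun u => dot (T u) v : R[i]^o) m.
  exact: (riesz F).
have [s sP] := choice ex.
have ls : linear s.
  move=> a x y; apply: dot_injr => u.
  by rewrite -sP linearPr linearPr /= -!sP.
pose m := GRing.isLinear.Build _ _ _ _ _ ls.
pose F : {linear H -> H} := HB.pack s m.
by exists (linfun F) => u v; rewrite lfunE /= sP.
Qed.

End Operators.

Section CompletelyPositive.
Variables (R : realType) (A : cstarAlgType R).
Variables (H : vectType R[i]) (dot : {dot H for @Num.conj R[i]}).
Implicit Types Phi : A -> 'End(H).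

Definition mxstar m n (M : 'M[A]_(m, n)) : 'M[A]_(n, m) :=
  (map_mx (@star R A) M)^T.

Definition mx_pos n (M : 'M[A]_n) : Prop :=
  exists N : 'M[A]_n, M = mxstar N *m N.

Definition CP : set (A -> 'End(H)) := [set Phi | linear Phi /\
  forall n (M : 'M[A]_n), mx_pos M -> opmx_pos dot (map_mx Phi M)].

(* ||Phi a|| <= ||a|| for all a, with the operator norm on B(H) unfolded. *)
Definition contractive Phi : Prop :=
  forall a h, hnorm dot (Phi a h) <= cnorm a * hnorm dot h.

Definition CCP : set (A -> 'End(H)) :=
  [set Phi | CP Phi /\ contractive Phi].

Definition cstar_comb n (T : 'I_n -> 'End(H)) (Phi_ : 'I_n -> A -> 'End(H))
    Phi : Prop :=
  [/\ (0 < n)%N,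
      \sum_(j < n) (adj dot (T j) \o T j)%VF = \1%VF &
      forall a, Phi a = \sum_(j < n) Ad dot (T j) (Phi_ j a)].

Definition cstar_extreme : set (A -> 'End(H)) :=
  [set Phi | CCP Phi /\
    forall n (T : 'I_n -> 'End(H)) (Phi_ : 'I_n -> A -> 'End(H)),
      (forall j, CCP (Phi_ j)) -> (forall j, op_invertible (T j)) ->
      cstar_comb T Phi_ Phi ->
      exists U : 'I_n -> 'End(H), forall j,
        op_unitary dot (U j) /\ forall a, Phi_ j a = Ad dot (U j) (Phi a)].

Definition cstar_hull (S : set (A -> 'End(H))) : set (A -> 'End(H)) :=
  [set Phi | exists n (T : 'I_n -> 'End(H)) (Phi_ : 'I_n -> A -> 'End(H)),
    (forall j, S (Phi_ j)) /\ cstar_comb T Phi_ Phi].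

(* The weak* topology of B(A, B(H)) is induced by its predual, the projective
   tensor product of A and B(H)_*. As H is finite-dimensional, so is B(H)_*,
   and the predual consists of the finite sums of elementary tensors
   a (x) <_ h, k>. The topology is therefore the initial one for the
   functionals Phi |-> <Phi a h, k>. *)
Definition bw_eval Phi : {ptws A * H * H -> R[i]^o} :=
  fun p => dot (Phi p.1.1 p.1.2) p.2.

(* Closure in the topology induced on CP by the BW topology. *)
Definition bw_closure_CP (S : set (A -> 'End(H))) : set (A -> 'End(H)) :=
  CP `&` closure (S : set (initial_topology bw_eval)).

End CompletelyPositive.

Arguments CP {R} A {H} dot.
Arguments CCP {R} A {H} dot.
Arguments cstar_extreme {R} A {H} dot.

(* Main.v *)
Require Import Defs.
From HB Require Import structures.
From mathcomp Require Import all_boot all_order all_algebra.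
From mathcomp Require Import complex.
From mathcomp Require Import all_classical all_reals all_analysis.
From mathcomp Require Import ring lra.

(* Let n = dim H. A completely positive map Psi is pure if every completely
   positive map Phi with Psi - Phi completely positive is a multiple of Psi.

   - If Psi is pure and Psi(1) is a projection P, then Psi is C*-extreme: in a
     C*-convex decomposition of Psi, purity gives Ad_{T_j} Phi_j = t_j Psi, and
     comparing at 1 forces T_j^* T_j P = t_j P, so that T_j P is a multiple of a
     partial isometry, which extends to a unitary. Every pure map is Ad_T of such
     a map, where T^* T = Psi(1).
   - Completely positive maps are the positive functionals on M_n(A). Given y in
     M_n(A) and a normalised Phi, there is a normalised pure Psi with
     Re Phi(y) <= Re Psi(y). This is the extreme point of a face of the state
     space; faces are encoded by their support functions, which are sublinear
     functionals, and Zorn's lemma on these replaces compactness.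
   - Consequently, by a greedy choice, finitely many values of Phi are
     approximated by those of an average of pure maps. After a small rescaling
     its value at 1 is at most I; the pure maps factor through C*-extreme ones
     and the zero map, which is C*-extreme, fills the gap to I. *)

Set Implicit Arguments.
Unset Strict Implicit.
Unset Printing Implicit Defensive.

Import Order.TTheory GRing.Theory Num.Theory.
Import numFieldNormedType.Exports.

Local Open Scope classical_set_scope.
Local Open Scope ring_scope.

(** * Real parts of complex numbers, and nonnegative quadratic forms *)

Section ComplexNumbers.
Variable R : realType.
Implicit Types (x y z : R[i]) (r : R).

Lemma Re_add x y : complex.Re (x + y) = complex.Re x + complex.Re y.
Proof. by case: x => a b; case: y => c d. Qed.

Lemma Re_realM r x : complex.Re (r%:C%C * x) = r * complex.Re x.
Proof. by case: x => a b /=; rewrite mul0r subr0. Qed.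

Lemma Re_sum (I : Type) (s : seq I) (P : pred I) (F : I -> R[i]) :
  complex.Re (\sum_(i <- s | P i) F i) = \sum_(i <- s | P i) complex.Re (F i).
Proof. exact: (big_morph _ Re_add (erefl _)). Qed.

Lemma ge0_ReE x : 0 <= x -> x = (complex.Re x)%:C%C.
Proof. by move=> x0; rewrite RRe_real // ger0_real. Qed.

Lemma Re_ge0 x : 0 <= x -> 0 <= complex.Re x.
Proof. by rewrite lecE => /andP[]. Qed.

Lemma ler_Re x y : x <= y -> complex.Re x <= complex.Re y.
Proof. by rewrite lecE => /andP[]. Qed.

Lemma Re_le_norm x : (complex.Re x)%:C%C <= `|x|.
Proof. by apply: le_trans (normc_ge_Re x); rewrite lecR ler_norm. Qed.

(** Transfers identities and estimates for the real parts of [x] and ['i * x] to [x] itself. *)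
Lemma complex_ReE x :
  x = (complex.Re x)%:C%C - 'i * (complex.Re ('i * x))%:C%C.
Proof.
case: x => a b; apply/eqP; rewrite eq_complex /=.
by apply/andP; split; apply/eqP; rewrite ?(mul0r, mul1r, subr0, sub0r, add0r,
  addr0, mulr0, oppr0, opprK).
Qed.

(* The Cauchy-Schwarz inequality for the coefficients of a nonnegative quadratic
   form; the first conclusion is its hermitian symmetry. *)
Lemma sesqui_quad_ge0 (a b c d : R[i]) : 0 <= d ->
    (forall z, 0 <= a + z^* * b + z * c + z * z^* * d) ->
  c = b^* /\ `|b| ^+ 2 <= a * d.
Proof.
move=> d0 q.
have a0 : 0 <= a by have := q 0; rewrite conjC0 !mul0r !addr0.
have dC : d^* = d by apply/CrealP/ger0_real.
have aC : a^* = a by apply/CrealP/ger0_real.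
have cE : c = b^*.
  (* The form is real at [1] and at ['i]; these two equations determine [c]. *)
  have /ger0_real/CrealP := q 1; have /ger0_real/CrealP := q 'i.
  rewrite !(rmorphD, rmorphM) /= !conjCK conjC1 conjCi dC aC => e1 e2.
  have {}e2 : b^* + c^* = b + c.
    by apply: (addrI a); apply: (addIr d); move: e2; rewrite !mul1r !addrA.
  have {}e1 : 'i * (b^* - c^*) = 'i * (c - b).
    apply: (addrI a); apply: (addIr ('i * - 'i * d)).
    transitivity (a + 'i * b^* + - 'i * c^* + - 'i * 'i * d); first by ring.
    by rewrite e1; ring.
  have {}e1 := mulfI (neq0Ci _) e1.
  have : 2%:R * c = 2%:R * b^*.
    rewrite !mulr_natl !mulr2n.
    have -> : c + c = (b + c) + (c - b) by ring.
    by rewrite -e1 -e2; ring.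
  by apply: mulfI; rewrite pnatr_eq0.
split=> //; rewrite {}cE in q.
have nb : b * b^* = `|b| ^+ 2 by rewrite normCK.
have [d_eq0|dn0] := eqVneq d 0.
  rewrite d_eq0 mulr0; have [->|bn0] := eqVneq b 0.
    by rewrite normr0 expr0n.
  have nb0 : `|b| ^+ 2 != 0 by rewrite expf_eq0 normr_eq0.
  (* With this [t] the form at [- t * b] equals [- (a + 2)], which is negative. *)
  pose t := (a + 1) / `|b| ^+ 2.
  have tC : t^* = t.
    by apply/CrealP/ger0_real; rewrite divr_ge0 ?exprn_ge0 // addr_ge0.
  have := q (- t * b); rewrite d_eq0 mulr0 addr0 rmorphM rmorphN /= tC.
  have -> : a + - t * b^* * b + - t * b * b^* = a - 2%:R * (t * (b * b^*)) by ring.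
  rewrite nb /t divfK // (_ : a - _ = - (a + 2)); last by ring.
  have a2 : 0 < a + 2 by rewrite ltr_wpDl.
  by rewrite oppr_ge0 => /(lt_le_trans a2); rewrite ltxx.
have dp : 0 < d by rewrite lt_def dn0.
(* The minimiser of the form. *)
have := q (- (b / d)).
rewrite rmorphN rmorphM /= fmorphV /= dC.
have -> : a + - (b^* / d) * b + - (b / d) * b^* + - (b / d) * - (b^* / d) * d
   = a - (b * b^*) / d.
  by field.
by rewrite nb subr_ge0 ler_pdivrMr.
Qed.

End ComplexNumbers.

(** * Operators on a finite-dimensional Hilbert space: factorisation and unitary extension *)

Section FiniteDimensionalOperators.
Variables (R : realType) (H : vectType R[i]) (dot : {dot H for @Num.conj R[i]}).
Implicit Types (T X Y Q P : 'End(H)) (h k u v e : H) (c : R[i]).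

Lemma dotC h k : dot h k = (dot k h)^*.
Proof. by rewrite [LHS]hermC expr0 mul1r. Qed.

Lemma dotDl h k u : dot (h + k) u = dot h u + dot k u.
Proof. exact: linearDl. Qed.
Lemma dotDr h k u : dot u (h + k) = dot u h + dot u k.
Proof. exact: linearDr. Qed.
Lemma dotBl h k u : dot (h - k) u = dot h u - dot k u.
Proof. exact: linearBl. Qed.
Lemma dotBr h k u : dot u (h - k) = dot u h - dot u k.
Proof. exact: linearBr. Qed.
Lemma dotZl c h u : dot (c *: h) u = c * dot h u.
Proof. by rewrite linearZl_LR. Qed.
Lemma dotZr c h u : dot u (c *: h) = c^* * dot u h.
Proof. by rewrite linearZr_LR. Qed.
Lemma dotNl h u : dot (- h) u = - dot h u. Proof. exact: linearNl. Qed.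
Lemma dot0l u : dot 0 u = 0. Proof. exact: linear0l. Qed.
Lemma dot0r u : dot u 0 = 0. Proof. exact: linear0r. Qed.
Lemma dot_suml (I : Type) (s : seq I) (p : pred I) (F : I -> H) u :
  dot (\sum_(i <- s | p i) F i) u = \sum_(i <- s | p i) dot (F i) u.
Proof. exact: linear_sumlz. Qed.
Lemma dot_sumr (I : Type) (s : seq I) (p : pred I) (F : I -> H) u :
  dot u (\sum_(i <- s | p i) F i) = \sum_(i <- s | p i) dot u (F i).
Proof. exact: linear_sumr. Qed.

Lemma dot_injl h k : (forall u, dot h u = dot k u) -> h = k.
Proof. by move=> e; apply: (@dot_injr _ _ dot) => u; rewrite dotC e -dotC. Qed.

Lemma dot_eq0 h : dot h h = 0 -> h = 0.
Proof. by move/eqP; rewrite dnorm_eq0 => /eqP. Qed.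

Lemma lfunD T h k : T (h + k) = T h + T k. Proof. exact: linearD. Qed.
Lemma lfunB T h k : T (h - k) = T h - T k. Proof. exact: linearB. Qed.
Lemma lfunZ T c h : T (c *: h) = c *: T h. Proof. exact: linearZ. Qed.
Lemma lfun_sum T (I : Type) (s : seq I) (p : pred I) (F : I -> H) :
  T (\sum_(i <- s | p i) F i) = \sum_(i <- s | p i) T (F i).
Proof. exact: linear_sum. Qed.

Lemma lfun_dot_eq X Y : (forall h k, dot (X h) k = dot (Y h) k) -> X = Y.
Proof. by move=> e; apply/lfunP => h; apply: dot_injl => k. Qed.

Lemma adj_eq T X : (forall h k, dot (T h) k = dot h (X k)) -> adj dot T = X.
Proof.
move=> e; apply/lfunP => k; apply: (@dot_injr _ _ dot) => h.
by rewrite -adjP e.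
Qed.

Lemma adjPr T h k : dot h (T k) = dot (adj dot T h) k.
Proof. by rewrite dotC adjP -dotC. Qed.

Lemma adjK T : adj dot (adj dot T) = T.
Proof. by apply: adj_eq => h k; rewrite adjPr. Qed.

Lemma adj_comp T X : adj dot (T \o X)%VF = (adj dot X \o adj dot T)%VF.
Proof. by apply: adj_eq => h k; rewrite !comp_lfunE !adjP. Qed.

Lemma adjD T X : adj dot (T + X) = adj dot T + adj dot X.
Proof. by apply: adj_eq => h k; rewrite !add_lfunE dotDl dotDr !adjP. Qed.

Lemma adjZ c T : adj dot (c *: T) = c^* *: adj dot T.
Proof. by apply: adj_eq => h k; rewrite !scale_lfunE dotZl dotZr conjCK adjP. Qed.

Lemma adj1 : adj dot \1%VF = \1%VF.
Proof. by apply: adj_eq => h k; rewrite !id_lfunE. Qed.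

Lemma adj0 : adj dot 0 = 0.
Proof. by apply: adj_eq => h k; rewrite !zero_lfunE dot0l dot0r. Qed.

Lemma AdE T X h k : dot (Ad dot T X h) k = dot (X (T h)) (T k).
Proof. by rewrite /Ad !comp_lfunE dotC -adjP -dotC. Qed.

Lemma Ad_comp T S X : Ad dot S (Ad dot T X) = Ad dot (T \o S)%VF X.
Proof. by apply: lfun_dot_eq => h k; rewrite !AdE !comp_lfunE. Qed.

Lemma AdD T X Y : Ad dot T (X + Y) = Ad dot T X + Ad dot T Y.
Proof.
by apply: lfun_dot_eq => h k; rewrite add_lfunE dotDl !AdE add_lfunE dotDl.
Qed.

Lemma AdZ T c X : Ad dot T (c *: X) = c *: Ad dot T X.
Proof.
by apply: lfun_dot_eq => h k; rewrite scale_lfunE dotZl !AdE scale_lfunE dotZl.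
Qed.

Lemma Ad0 T : Ad dot T 0 = 0.
Proof. by rewrite -[X in Ad _ _ X](scale0r 0) AdZ scale0r. Qed.

Lemma Ad1 X : Ad dot \1%VF X = X.
Proof. by apply: lfun_dot_eq => h k; rewrite AdE !id_lfunE. Qed.

Lemma AdZl c T X : Ad dot (c *: T) X = (c * c^*) *: Ad dot T X.
Proof.
apply: lfun_dot_eq => h k; rewrite scale_lfunE dotZl !AdE !scale_lfunE.
by rewrite lfunZ dotZl dotZr mulrA.
Qed.

Definition op_pos Q := forall h, 0 <= dot (Q h) h.

Lemma op_pos_cs Q h k : op_pos Q ->
  dot (Q k) h = (dot (Q h) k)^* /\
  `|dot (Q h) k| ^+ 2 <= dot (Q h) h * dot (Q k) k.
Proof.
move=> p; apply: sesqui_quad_ge0 => // z.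
have := p (h + z *: k); rewrite lfunD lfunZ.
rewrite !dotDl !dotDr !dotZl !dotZr.
by congr (0 <= _); ring.
Qed.

Lemma op_pos_adj Q : op_pos Q -> adj dot Q = Q.
Proof.
move=> p; apply: adj_eq => h k.
by have [-> _] := op_pos_cs k h p; rewrite -dotC.
Qed.

Lemma op_pos_eq0 Q h : op_pos Q -> dot (Q h) h = 0 -> Q h = 0.
Proof.
move=> p e; apply: dot_injl => k; rewrite dot0l.
have [_] := op_pos_cs h k p; rewrite e mul0r => le0.
apply/eqP; rewrite -normr_eq0 -sqrf_eq0 eq_le le0 /=.
by rewrite exprn_ge0.
Qed.

Definition ketbra_fun e u h := dot h u *: e.

Fact ketbra_is_linear e u : linear (ketbra_fun e u).
Proof. by move=> c h k; rewrite /ketbra_fun dotDl dotZl scalerDl scalerA. Qed.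

HB.instance Definition _ e u :=
  GRing.isLinear.Build R[i] H H _ (ketbra_fun e u) (ketbra_is_linear e u).

Definition ketbra e u : 'End(H) := linfun (ketbra_fun e u).

Lemma ketbraE e u h : ketbra e u h = dot h u *: e.
Proof. by rewrite lfunE. Qed.

Definition orthonormal_basis n (b : 'I_n -> H) :=
  (forall i j, dot (b i) (b j) = (i == j)%:R) /\
  (forall h, h = \sum_i dot h (b i) *: b i).

(** A nonzero vector orthogonal to a family enlarges it after normalisation. Hence for each [m]
    there is a maximal orthonormal family or one of size [m]; since orthonormal families are free,
    the second case fails one above the dimension. *)
Lemma orthonormal_basis_ex : exists n (b : 'I_n -> H), orthonormal_basis b.
Proof.
suff [s [so sp]] : exists s : seq H, orthonormal dot s /\
    forall h, (forall v, v \in s -> dot h v = 0) -> h = 0.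
  move/orthonormalP: so => [us so].
  exists (size s), (fun i => s`_i); split=> [i j|h].
    by rewrite so ?mem_nth // nth_uniq.
  apply/eqP; rewrite -subr_eq0; apply/eqP/sp => v vs.
  rewrite dotBl dot_suml.
  have vi : (index v s < size s)%N by rewrite index_mem.
  rewrite (bigD1 (Ordinal vi)) //= nth_index // dotZl (so v v) // eqxx mulr1.
  rewrite opprD addrA subrr sub0r big1 ?oppr0 // => i ni.
  rewrite dotZl (so s`_i v) ?mem_nth // -[X in _ == X](nth_index 0 vs) nth_uniq //.
  by rewrite -(inj_eq val_inj) /= in ni; rewrite (negbTE ni) mulr0.
have grow m : exists s : seq H, orthonormal dot s /\
  ((forall h, (forall v, v \in s -> dot h v = 0) -> h = 0) \/ size s = m).
  elim: m => [|m [s [so [sp|sm]]]].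
  - by exists [::]; split; last by right.
  - by exists s; split=> //; left.
  have [sp|] := pselect (forall h, (forall v, v \in s -> dot h v = 0) -> h = 0).
    by exists s; split=> //; left.
  move=> /existsNP[h /not_implyP[hs /eqP hn0]].
  have nh : 0 < hnorm dot h by rewrite sqrt_dnorm_gt0.
  exists (((hnorm dot h)^-1 *: h) :: s); split; last by right; rewrite /= sm.
  have hh : dot ((hnorm dot h)^-1 *: h) ((hnorm dot h)^-1 *: h) = 1.
    rewrite dotZl dotZr fmorphV /= (CrealP _) ?ger0_real ?ltW //.
    by rewrite mulrA -invfM -expr2 sqrtCK mulVf // dnorm_eq0.
  set v := _ *: h in hh *.
  have vs u : u \in s -> dot v u = 0 by move=> us; rewrite dotZl hs // mulr0.
  have vNs : v \notin s.
    by apply/negP => /vs; rewrite hh => /eqP; rewrite oner_eq0.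
  move/orthonormalP: so => [us so].
  apply/orthonormalP; split; first by rewrite /= vNs.
  move=> x y; rewrite !inE => /predU1P[->|xs] /predU1P[->|ys].
  - by rewrite hh eqxx.
  - by rewrite vs //; case: eqP => // vy; rewrite vy ys in vNs.
  - by rewrite dotC vs // conjC0; case: eqP => // xv; rewrite -xv xs in vNs.
  - exact: so.
have [s [so [sp|sz]]] := grow (\dim {:H}).+1; first by exists s.
have /eqP := orthonormal_free so; rewrite sz => e.
by have := dimvS (subvf (span s)); rewrite e ltnn.
Qed.

Lemma normalizer h : h != 0 ->
  exists c : R[i], [/\ c != 0, c^* = c & c * c * dot h h = 1].
Proof.
move=> hn0; exists (hnorm dot h)^-1.
have nh : 0 < hnorm dot h by rewrite sqrt_dnorm_gt0.
split; first by rewrite invr_eq0 gt_eqF.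
  by apply/CrealP/ger0_real; rewrite invr_ge0 ltW.
by rewrite -invfM -expr2 sqrtCK mulVf // dnorm_eq0.
Qed.

(** Cholesky elimination along an orthonormal basis. After [m] pivots, [Q] is [T^* T] plus a
    positive remainder [Q'] that kills the first [m] basis vectors, while the range of [T] is
    orthogonal to the other ones. *)
Lemma op_pos_factor Q : op_pos Q -> exists T, (adj dot T \o T)%VF = Q.
Proof.
move=> Qp; have [n [b [bo bE]]] := orthonormal_basis_ex.
suff /(_ n (leqnn n))[T [Q' [Q'p QE Q'0 _]]] : forall m, (m <= n)%N ->
    exists T Q', [/\ op_pos Q',
      forall h k, dot (Q h) k = dot (T h) (T k) + dot (Q' h) k,
      forall i : 'I_n, (i < m)%N -> Q' (b i) = 0 &
      forall i : 'I_n, (m <= i)%N -> adj dot T (b i) = 0].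
  exists T; apply: lfun_dot_eq => h k.
  rewrite comp_lfunE dotC -adjP -dotC QE [Q' h](_ : _ = 0) ?dot0l ?addr0 //.
  rewrite (bE h) lfun_sum big1 // => i _.
  by rewrite lfunZ /= Q'0 // scaler0.
elim=> [_|m IH mn].
  by exists 0, Q; split=> // [h k|i _]; rewrite ?adj0 ?zero_lfunE ?dot0l ?add0r.
have [T [Q' [Q'p QE Q'0 T0]]] := IH (ltnW mn).
pose v := b (Ordinal mn); pose a := dot (Q' v) v.
have Tv : adj dot T v = 0 by rewrite T0.
(* A zero pivot means that [Q'] already kills [v]. *)
have [a0|an0] := eqVneq a 0.
  exists T, Q'; split=> // i; last by move=> /ltnW; exact: T0.
  rewrite ltnS leq_eqVlt => /predU1P[im|]; last exact: Q'0.
  by rewrite (_ : i = Ordinal mn); [exact: op_pos_eq0|exact: val_inj].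
have ap : 0 < a by rewrite lt_def an0 Q'p.
pose s := sqrtC a; have sp : 0 < s by rewrite sqrtC_gt0.
have sC : s^* = s by apply/CrealP/ger0_real/ltW.
have sn0 : s != 0 by rewrite gt_eqF.
have ss : s * s = a by rewrite -expr2 sqrtCK.
(* The new remainder [Q' - ketbra w w] is the Schur complement of the pivot: it kills [v], and it is
   positive by Cauchy-Schwarz for [Q']. *)
pose w := s^-1 *: Q' v.
have dw h : dot h w = s^-1 * dot (Q' h) v.
  by rewrite dotZr fmorphV /= sC -{1}(op_pos_adj Q'p) -adjP.
have wE : w = s^-1 *: Q' v by [].
clearbody w.
exists (T + ketbra v w), (Q' - ketbra w w); split.
- move=> h; rewrite add_lfunE opp_lfunE ketbraE dotBl dotZl subr_ge0.
  rewrite [dot w h]dotC -normCK dw normrM exprMn.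
  rewrite [`|s^-1|]gtr0_norm ?invr_gt0 // exprVn ler_pdivrMl ?exprn_gt0 //.
  by rewrite [s ^+ 2]expr2 ss mulrC; have [] := op_pos_cs h v Q'p.
- move=> h k; rewrite QE !add_lfunE opp_lfunE !ketbraE.
  rewrite !(dotDl, dotDr, dotBl, dotZl, dotZr).
  rewrite [dot (T h) v]adjP [dot v (T k)]adjPr Tv dot0l dot0r.
  rewrite bo eqxx dotNl dotZl [dot w k]dotC /=; ring.
- move=> i; rewrite ltnS add_lfunE opp_lfunE ketbraE dw.
  rewrite leq_eqVlt => /predU1P[im|im]; last first.
    by rewrite Q'0 // dot0l mulr0 scale0r subr0.
  rewrite (_ : i = Ordinal mn) -/v -/a; last exact: val_inj.
  by rewrite wE scalerA mulrAC -invfM ss mulVf // scale1r subrr.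
- move=> i mi; rewrite adjD add_lfunE (T0 _ (ltnW mi)) add0r.
  apply: (@dot_injr _ _ dot) => h; rewrite -adjP ketbraE dotZl bo dot0r.
  rewrite (_ : _ == i = false) ?mulr0 //.
  by apply/negbTE; rewrite -(inj_eq val_inj) /= ltn_eqF.
Qed.

(** [Z] is [Q^{-1} T^*] for [Q = T^* T], inverted on its range only; then [T Z] is the orthogonal
    projection onto the range of [T]. *)
Lemma generalized_inverse T :
  exists Z, (T \o Z \o T)%VF = T /\ adj dot (T \o Z)%VF = (T \o Z)%VF.
Proof.
pose Q := (adj dot T \o T)%VF; pose G := (Q^-1)%VF.
have QGQ : (Q \o G \o Q)%VF = Q.
  rewrite /G; move: @G => _; move: (Q) => X; apply/lfunP => h.
  rewrite comp_lfunE [LHS]comp_lfunE; apply: limg_lfunVK.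
  by rewrite memv_img // memvf.
have Qadj : adj dot Q = Q by rewrite adj_comp adjK.
(* The adjoint is injective on the range of [T], so that it can be cancelled from [Q G Q = Q]. *)
have T_inj x y : adj dot T (T x) = adj dot T (T y) -> T x = T y.
  move=> e; apply/eqP; rewrite -subr_eq0; apply/eqP/dot_eq0.
  by rewrite -lfunB adjP lfunB /= lfunB /= e subrr dot0r.
have TGT : (T \o G \o adj dot T \o T)%VF = T.
  apply/lfunP => h; rewrite !comp_lfunE; apply: T_inj.
  by have /lfunP/(_ h) := QGQ; rewrite !comp_lfunE.
exists (G \o adj dot T)%VF; rewrite !comp_lfunA; split=> //.
set E := (T \o G \o adj dot T)%VF.
(* Hence [E^* E = E], and a product of this form is self-adjoint. *)
have ET : (adj dot E \o T)%VF = T.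
  apply/lfunP => h; rewrite !adj_comp adjK !comp_lfunE; apply: T_inj.
  have /(congr1 (adj dot))/lfunP/(_ h) := QGQ.
  by rewrite !adj_comp !adjK !comp_lfunE.
have EE : (adj dot E \o E)%VF = E.
  by rewrite {2}/E !comp_lfunA ET.
by rewrite -{1}EE adj_comp adjK.
Qed.

Lemma comp_lfun_eq1 T X : (T \o X)%VF = \1%VF -> (X \o T)%VF = \1%VF.
Proof.
move=> TX; have X0 : lker X == 0%VS.
  apply/lker0P => h k e; have /lfunP eT := TX.
  by rewrite -[h]id_lfunE -[k]id_lfunE -!eT !comp_lfunE e.
rewrite -[RHS](lker0_compfV X0); congr (_ \o _)%VF.
by rewrite -[T]comp_lfun1r -(lker0_compfV X0) comp_lfunA TX comp_lfun1l.
Qed.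

(** The partial isometry [V] is enlarged one dimension at a time. At stage [m] the partial isometry
    [W] agrees with [V] on the range of [P], and its initial space contains this range and the first
    [m] basis vectors. *)
Lemma unitary_extension V : (V \o adj dot V \o V)%VF = V ->
  exists2 W, op_unitary dot W & (W \o (adj dot V \o V))%VF = V.
Proof.
move=> VVV; pose P := (adj dot V \o V)%VF.
have [n [b [bo bE]]] := orthonormal_basis_ex.
suff /(_ n (leqnn n))[W [W1 W2 W3 W4]] : forall m, (m <= n)%N ->
    exists W, [/\ (W \o adj dot W \o W)%VF = W, (W \o P)%VF = V,
      forall h, adj dot W (W (P h)) = P h &
      forall i : 'I_n, (i < m)%N -> adj dot W (W (b i)) = b i].
  have W1' : (adj dot W \o W)%VF = \1%VF.
    apply/lfunP => h; rewrite (bE h) !lfun_sum; apply: eq_bigr => i _.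
    by rewrite !lfunZ /= comp_lfunE W4 // id_lfunE.
  by exists W => //; split=> //; exact: comp_lfun_eq1.
elim=> [_|m IH mn].
  have VP : (V \o P)%VF = V by rewrite /P comp_lfunA.
  exists V; split=> // h; have /lfunP/(_ h) := VVV.
  by rewrite /P !comp_lfunE => ->.
have [W [W1 W2 W3 W4]] := IH (ltnW mn).
have W1' h : W (adj dot W (W h)) = W h.
  by rewrite -[RHS](congr1 (fun X : 'End(H) => X h) W1) !comp_lfunE.
have W1a h : adj dot W (W (adj dot W h)) = adj dot W h.
  rewrite -[RHS](congr1 (fun X : 'End(H) => adj dot X h) W1).
  by rewrite !adj_comp adjK !comp_lfunE.
pose v := b (Ordinal mn); pose x := v - adj dot W (W v).
have [x0|xn0] := eqVneq x 0.
  exists W; split=> // i; rewrite ltnS leq_eqVlt => /predU1P[im|]; last exact: W4.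
  rewrite (_ : i = Ordinal mn); last exact: val_inj.
  by apply/esym/eqP; rewrite -subr_eq0; apply/eqP.
(* Room is left in the target: if [W W^*] were the identity, then so would be [W^* W], contradicting
   [x != 0]. *)
have [y yn0] : exists y, y - W (adj dot W y) != 0.
  apply: contrapT => /forallNP Ny; move/eqP: xn0; apply.
  have /comp_lfun_eq1/lfunP/(_ v) : (W \o adj dot W)%VF = \1%VF.
    apply/lfunP => y; rewrite comp_lfunE id_lfunE; apply/esym/eqP.
    by rewrite -subr_eq0; have /negP := Ny y; rewrite negbK.
  by rewrite /x comp_lfunE id_lfunE => ->; rewrite subrr.
have [c [cn0 cC c1]] := normalizer xn0.
have [d [dn0 dC d1]] := normalizer yn0.
pose e := c *: x; pose f := d *: (y - W (adj dot W y)).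
have We : W e = 0 by rewrite /e lfunZ /= lfunB /= W1' subrr scaler0.
have Wf : adj dot W f = 0.
  by rewrite /f lfunZ /= lfunB /= W1a subrr scaler0.
have ff : dot f f = 1 by rewrite dotZl dotZr dC mulrA.
have ee : dot e e = 1 by rewrite dotZl dotZr cC mulrA.
have WWe h : dot (adj dot W (W h)) e = 0 by rewrite -adjPr We dot0r.
have Whf h : dot (W h) f = 0 by rewrite adjP Wf dot0r.
have eE : e = c *: x by [].
clearbody e f.
have Pe h : dot (P h) e = 0 by rewrite -W3 WWe.
(* The unit vector [e] of the kernel of [W] is sent to the unit vector [f] of the kernel of
   [W^*]. *)
pose W' := W + ketbra f e.
have W'E h : W' h = W h + dot h e *: f by rewrite add_lfunE ketbraE.
have adjW'E h : adj dot W' h = adj dot W h + dot h f *: e.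
  apply: (@dot_injr _ _ dot) => k; rewrite -adjP W'E dotDl dotDr dotZl dotZr adjP.
  by rewrite [dot f h]dotC [X in _ + X = _]mulrC.
have PW'E h : adj dot W' (W' h) = adj dot W (W h) + dot h e *: e.
  rewrite adjW'E W'E lfunD lfunZ /= Wf scaler0 addr0.
  by rewrite dotDl Whf add0r dotZl ff mulr1.
exists W'; split.
- apply/lfunP => h; rewrite !comp_lfunE PW'E [RHS]W'E W'E lfunD lfunZ /=.
  by rewrite We scaler0 addr0 W1' dotDl WWe add0r dotZl ee mulr1.
- apply/lfunP => h; rewrite comp_lfunE W'E Pe scale0r addr0 -W2.
  by rewrite comp_lfunE.
- by move=> h; rewrite PW'E Pe scale0r addr0 W3.
- move=> i; rewrite PW'E ltnS leq_eqVlt => /predU1P[im|im]; last first.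
    have -> : dot (b i) e = 0 by rewrite -(W4 i im) WWe.
    by rewrite W4 // scale0r addr0.
  rewrite (_ : i = Ordinal mn) -/v; last exact: val_inj.
  have -> : dot v e *: e = x; last by rewrite /x addrC subrK.
  have -> : dot v e = dot x e by rewrite /x dotBl WWe subr0.
  by rewrite eE dotZr scalerA cC mulrAC c1 scale1r.
Qed.

End FiniteDimensionalOperators.

(** * Norm, involution and square roots in a C*-algebra *)

Section CStarAlgebras.
Variables (R : realType) (A : cstarAlgType R).
Implicit Types (x y z a b : A).

Lemma cnorm0 : cnorm (0 : A) = 0.
Proof. by rewrite -(scale0r (0 : A)) cnormZ normr0 mul0r. Qed.

Lemma cnormN x : cnorm (- x) = cnorm x.
Proof. by rewrite -scaleN1r cnormZ normrN1 mul1r. Qed.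

Lemma cnorm_ge0 x : 0 <= cnorm x.
Proof.
have := ler_cnormD x (- x); rewrite subrr cnorm0 cnormN -mulr2n.
by rewrite pmulrn_lge0.
Qed.

Lemma cnorm_dist x y z : cnorm (x - z) <= cnorm (x - y) + cnorm (y - z).
Proof. by apply: le_trans (ler_cnormD _ _); rewrite addrA subrK. Qed.

Lemma star1 : star (1 : A) = 1.
Proof. by rewrite -[LHS]mulr1 -{2}[1]starK -starM mulr1 starK. Qed.

Lemma star0 : star (0 : A) = 0.
Proof. by rewrite -(scale0r (0 : A)) starZ conjC0 !scale0r. Qed.

Lemma starN x : star (- x) = - star x.
Proof. by rewrite -scaleN1r starZ rmorphN1 scaleN1r. Qed.

Lemma starB x y : star (x - y) = star x - star y.
Proof. by rewrite starD starN. Qed.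

Lemma star_sum (I : Type) (s : seq I) (P : pred I) (F : I -> A) :
  star (\sum_(i <- s | P i) F i) = \sum_(i <- s | P i) star (F i).
Proof. exact: (big_morph _ (@starD R A) star0). Qed.

Lemma cnorm1 : cnorm (1 : A) = 1.
Proof.
have n0 : cnorm (1 : A) != 0.
  by apply/eqP => /cnorm0_eq0/eqP; rewrite oner_eq0.
by apply: (mulfI n0); rewrite -expr2 -cnorm_starM star1 !mulr1.
Qed.

Lemma cnorm_star x : cnorm (star x) = cnorm x.
Proof.
have le y : cnorm y <= cnorm (star y).
  have [->|n0] := eqVneq (cnorm y) 0; first exact: cnorm_ge0.
  have p : 0 < cnorm y by rewrite lt_def n0 cnorm_ge0.
  by rewrite -(ler_pM2r p) -expr2 -cnorm_starM ler_cnormM.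
by apply/le_anti; rewrite le andbT -{2}(starK x) le.
Qed.

Lemma cnorm_le_eps x (c : R[i]) : 0 <= c ->
  (forall e, 0 < e -> cnorm x <= c * e) -> x = 0.
Proof.
move=> c0 le; apply: cnorm0_eq0; apply/eqP; rewrite eq_le cnorm_ge0 andbT.
have c1 : 0 < c + 1 by rewrite ltr_wpDl.
have [//|xn] := eqVneq (cnorm x) 0; first by move=> ->.
have xp : 0 < cnorm x by rewrite lt_def xn cnorm_ge0.
have := le _ (divr_gt0 xp c1).
rewrite mulrA ler_pdivlMr // mulrDr mulr1 [c * _]mulrC.
by rewrite -lerBrDl subrr.
Qed.

(* [y |-> (x + y^2) / 2] is a contraction, and a fixed point [y] of it
   satisfies [(1 - y)^2 = 1 - x]. *)
Lemma sqrt_one_sub x (q : R) : star x = x -> 0 <= q -> q < 1 ->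
  cnorm x <= q%:C%C -> exists b, star b = b /\ b * b = 1 - x.
Proof.
move=> xx q0 q1 xq; pose f y := 2^-1 *: (x + y * y).
pose Q : R[i] := q%:C%C.
have Q0 : 0 <= Q by rewrite ler0c.
have Q1 : Q < 1 by rewrite (ltcR q 1).
have half_ge0 : 0 <= 2^-1 :> R[i] by rewrite invr_ge0 ler0n.
have half_norm : `|2^-1 : R[i]| = 2^-1 by rewrite ger0_norm.
have fB y z : cnorm (f y - f z) <= 2^-1 * (cnorm y + cnorm z) * cnorm (y - z).
  rewrite /f -scalerBr cnormZ half_norm -mulrA ler_wpM2l //.
  have -> : x + y * y - (x + z * z) = y * (y - z) + (y - z) * z.
    by rewrite mulrBr mulrBl opprD addrACA subrr add0r addrA subrK.
  apply: le_trans (ler_cnormD _ _) _; rewrite [leRHS]mulrDl.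
  by rewrite lerD ?ler_cnormM // [leRHS]mulrC ler_cnormM.
(* The iterates stay in the ball of radius [q], on which [f] is Lipschitz with constant [q < 1]. *)
pose u n := iter n f 0.
have uQ n : cnorm (u n) <= Q.
  elim: n => [|n IH]; first by rewrite /u /= cnorm0.
  rewrite /u iterS -/(u n) /f cnormZ half_norm ler_pdivrMl ?ltr0n //.
  apply: le_trans (ler_cnormD _ _) _; rewrite mulr_natl mulr2n lerD //.
  apply: le_trans (ler_cnormM _ _) _; apply: (le_trans _ IH).
  by rewrite ler_piMl ?cnorm_ge0 // (le_trans IH) // ltW.
have uB n k : cnorm (u (n + k)%N - u n) <= Q ^+ n.
  elim: n => [|n IH].
    by rewrite add0n expr0 subr0 (le_trans (uQ k)) // ltW.
  rewrite addSn /u !iterS -/(u _) -/(u n) exprS.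
  apply: le_trans (fB _ _) _; rewrite ler_pM ?cnorm_ge0 //.
    by rewrite mulr_ge0 // addr_ge0 ?cnorm_ge0.
  by rewrite ler_pdivrMl ?ltr0n // mulr_natl mulr2n lerD.
have Qlim (e : R[i]) : 0 < e -> exists N, forall n, (N <= n)%N -> Q ^+ n < e.
  move=> e0; have eE := ge0_ReE (ltW e0).
  have e0' : 0 < complex.Re e by rewrite eE (ltcR 0) in e0.
  have : (fun n => q ^+ n) @ \oo --> (0 : R) by apply: cvg_expr; rewrite ger0_norm.
  move=> /cvgrPdist_lt/(_ _ e0')[N _ NP]; exists N => n /NP /=.
  rewrite sub0r normrN ger0_norm ?exprn_ge0 // => lt.
  by rewrite eE -rmorphXn /= (ltcR (q ^+ n)).
have [l lP] : exists l : A, forall e, 0 < e -> exists N : nat, forall n,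
    (N <= n)%N -> cnorm (u n - l) < e.
  apply: cnorm_complete => e e0; have [N NP] := Qlim e e0.
  have sym a b : cnorm (a - b) = cnorm (b - a) by rewrite -cnormN opprB.
  exists N => m n mN nN; wlog nm : m n mN nN / (n <= m)%N.
    by case/orP: (leq_total n m) => nm; [|rewrite sym]; apply.
  by apply: le_lt_trans (NP n nN); rewrite -{1}(subnKC nm) uB.
have ustar n : star (u n) = u n.
  elim: n => [|n IH]; first exact: star0.
  rewrite /u iterS -/(u n) /f starZ starD starM xx IH.
  by rewrite (CrealP _) // ger0_real.
have lstar : star l = l.
  apply/eqP; rewrite -subr_eq0; apply/eqP.
  apply: (@cnorm_le_eps _ 2) => [|e e0]; first exact: ler0n.
  have [N /(_ N (leqnn N)) NP] := lP e e0.
  apply: le_trans (cnorm_dist _ (u N) _) _.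
  rewrite mulr_natl mulr2n lerD ?(ltW NP) //.
  by rewrite -cnormN opprB -{1}ustar -starB cnorm_star ltW.
have lfix : f l = l.
  apply/eqP; rewrite -subr_eq0; apply/eqP.
  have [N1 N1P] := lP 1 ltr01.
  have ln : cnorm l <= 2.
    rewrite -[l](subrK (u N1)); apply: le_trans (ler_cnormD _ _) _.
    rewrite -[2]/(1 + 1) lerD //; last by rewrite (le_trans (uQ _)) // ltW.
    by rewrite -cnormN opprB ltW // N1P.
  apply: (@cnorm_le_eps _ 3) => [|e e0]; first exact: ler0n.
  have [N NP] := lP e e0.
  apply: le_trans (cnorm_dist _ (u N.+1) _) _.
  have -> : 3 * e = 2 * e + e by rewrite -[X in _ + X]mul1r -mulrDl -natr1.
  apply: lerD; last by rewrite ltW // NP.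
  rewrite [u _.+1]/u iterS -/(u N); apply: le_trans (fB _ _) _.
  apply: ler_pM; rewrite ?cnorm_ge0 //.
  - by rewrite mulr_ge0 // addr_ge0 ?cnorm_ge0.
  - rewrite ler_pdivrMl ?ltr0n // mulr_natl mulr2n lerD //.
    by rewrite (le_trans (uQ _)) // (le_trans (ltW Q1)) // ler1n.
  - by rewrite -cnormN opprB ltW // NP.
exists (1 - l); split; first by rewrite starB star1 lstar.
have e : x + l * l = l + l.
  rewrite -mulr2n -scaler_nat -[in RHS]lfix /f scalerA mulfV ?pnatr_eq0 //.
  by rewrite scale1r.
rewrite mulrBl mul1r mulrBr mulr1.
have -> : l * l = l + l - x by rewrite -e addrAC subrr add0r.
have -> : l - (l + l - x) = x - l.
  by rewrite opprB addrCA opprD [l + (_ + _)]addrA subrr sub0r.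
by rewrite opprB addrA subrK.
Qed.

(** By the C*-identity, [t^{-1} a^* a] has norm below 1, so [sqrt_one_sub] applies to it; its square
    root is then scaled by [sqrtC t]. *)
Lemma sqrt_sub_starM a (t : R) : cnorm a ^+ 2 < t%:C%C ->
  exists b, star b * b = t%:C%C *: 1 - star a * a.
Proof.
move=> at_; pose T : R[i] := t%:C%C.
have T0 : 0 < T by apply: le_lt_trans at_; rewrite exprn_ge0 // cnorm_ge0.
have TC : T^* = T by apply/CrealP/ger0_real/ltW.
have n0 : 0 <= cnorm (T^-1 *: (star a * a)) := cnorm_ge0 _.
have [||||b [bb bE]] :=
  @sqrt_one_sub (T^-1 *: (star a * a)) (complex.Re (cnorm (T^-1 *: (star a * a)))).
- by rewrite starZ starM starK fmorphV /= TC.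
- exact: Re_ge0.
- rewrite -(ltcR _ 1) -ge0_ReE // cnormZ cnorm_starM.
  by rewrite gtr0_norm ?invr_gt0 // ltr_pdivrMl // mulr1.
- by rewrite -ge0_ReE.
pose s := sqrtC T; have sC : s^* = s.
  by apply/CrealP/ger0_real; rewrite sqrtC_ge0 ltW.
exists (s *: b); rewrite starZ bb sC -scalerAl -scalerAr scalerA bE.
rewrite -expr2 sqrtCK scalerBr scalerA mulfV ?scale1r //.
by rewrite gt_eqF.
Qed.

End CStarAlgebras.

(** * Completely positive maps: inequalities and closure properties *)

Section CompletelyPositiveMaps.
Variables (R : realType) (A : cstarAlgType R).
Variables (H : vectType R[i]) (dot : {dot H for @Num.conj R[i]}).
Implicit Types (Phi Psi Theta : A -> 'End(H)) (a b : A) (h k : H).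
Implicit Types (T : 'End(H)).

(** A matrix [N^* N] is the sum of the matrices [w^* w] over the rows [w] of [N], so that single
    rows suffice. Conversely a nonempty row is completed by zero rows to a square matrix. *)
Lemma CPP Psi : CP A dot Psi <-> linear Psi /\
  forall m (w : 'I_m -> A) (h : 'I_m -> H),
    0 <= \sum_i \sum_j dot (Psi (star (w i) * w j) (h j)) (h i).
Proof.
split=> -[Pl Pp]; split=> //.
  move=> [|m] w h; first by rewrite big_ord0.
  pose N : 'M[A]_m.+1 := \matrix_(i, j) (if i == 0 then w j else 0).
  have /Pp/(_ h) : mx_pos (mxstar N *m N) by exists N.
  congr (0 <= _); apply: eq_bigr => i _; apply: eq_bigr => j _.
  rewrite !mxE (bigD1 ord0) //= big1 ?addr0 => [|r rn0]; rewrite !mxE //.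
  by rewrite (negbTE rn0) mulr0.
move=> n _ [N ->] h.
pose m := GRing.isLinear.Build _ _ _ _ _ Pl.
pose F : {linear A -> 'End(H)} := HB.pack Psi m.
have -> : \sum_(i < n) \sum_(j < n)
    dot (map_mx Psi (mxstar N *m N) i j (h j)) (h i) =
  \sum_r \sum_i \sum_j dot (Psi (star (N r i) * N r j) (h j)) (h i).
  rewrite [RHS]exchange_big; apply: eq_bigr => i _.
  rewrite [RHS]exchange_big; apply: eq_bigr => j _.
  rewrite !mxE -[Psi]/(F : A -> _) linear_sum sum_lfunE dot_suml.
  by apply: eq_bigr => r _; rewrite !mxE.
by apply: sumr_ge0 => r _; exact: (Pp n (N r) h).
Qed.

Lemma CP_linear Psi : CP A dot Psi -> linear Psi.
Proof. by case. Qed.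

Lemma CP_add Psi a b : CP A dot Psi -> Psi (a + b) = Psi a + Psi b.
Proof. by move=> /CP_linear/(_ 1 a b); rewrite !scale1r. Qed.

Lemma CP_0 Psi : CP A dot Psi -> Psi 0 = 0.
Proof.
move=> P; have := CP_add 0 0 P; rewrite addr0 => /eqP.
by rewrite -subr_eq0 opprD addrA subrr sub0r oppr_eq0 => /eqP.
Qed.

Lemma CP_scale Psi c a : CP A dot Psi -> Psi (c *: a) = c *: Psi a.
Proof.
by move=> P; have := CP_linear P c a 0; rewrite (CP_0 P) !addr0.
Qed.

Lemma CP_sq_ge0 Psi a h : CP A dot Psi -> 0 <= dot (Psi (star a * a) h) h.
Proof.
by move=> /CPP[_ /(_ 1%N (fun=> a) (fun=> h))]; rewrite !big_ord1.
Qed.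

Lemma CP_unit_pos Psi : CP A dot Psi -> op_pos dot (Psi 1).
Proof. by move=> P h; have := CP_sq_ge0 1 h P; rewrite star1 mulr1. Qed.

(** Positivity for the row [(a, 1)] at the vectors [(h, z *: k)] is a nonnegative quadratic form in
    [z]. *)
Lemma CP_cs Psi a h k : CP A dot Psi ->
  dot (Psi (star a) k) h = (dot (Psi a h) k)^* /\
  `|dot (Psi a h) k| ^+ 2 <= dot (Psi (star a * a) h) h * dot (Psi 1 k) k.
Proof.
move=> P; apply: sesqui_quad_ge0 => [|z]; first exact: CP_unit_pos.
have /CPP[_ /(_ 2%N (fun i => if i == 0 then a else 1)
                    (fun i => if i == 0 then h else z *: k))] := P.
rewrite !big_ord_recl !big_ord0 /= star1 !mul1r !mulr1 !addr0.
rewrite !lfunZ !dotZl !dotZr; congr (0 <= _); ring.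
Qed.

(** For real [t] above the squared norm of [a], [t 1 - a^* a] has the form [b^* b] and so a positive
    image; then [t] decreases to the squared norm. *)
Lemma CP_sq_le Psi a h : CP A dot Psi ->
  dot (Psi (star a * a) h) h <= cnorm a ^+ 2 * dot (Psi 1 h) h.
Proof.
move=> P.
have := CP_sq_ge0 a h P; set x := dot _ h => x0.
have := CP_unit_pos P h; set y := dot _ h => y0.
have s0 : 0 <= cnorm a ^+ 2 by rewrite exprn_ge0 // cnorm_ge0.
set s := cnorm a ^+ 2 in s0 *.
have le (t : R) : complex.Re s < t -> complex.Re x <= t * complex.Re y.
  move=> st; have : cnorm a ^+ 2 < t%:C%C by rewrite -/s (ge0_ReE s0) ltcR.
  move=> /sqrt_sub_starM[b bE]; have := CP_sq_ge0 b h P.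
  rewrite bE CP_add // -scaleN1r !CP_scale // add_lfunE !scale_lfunE.
  rewrite dotDl !dotZl mulN1r subr_ge0 -/x -/y => /ler_Re.
  by rewrite Re_realM.
rewrite (ge0_ReE x0) (ge0_ReE y0) (ge0_ReE s0) -rmorphM lecR.
have Ry : 0 <= complex.Re y by exact: Re_ge0.
apply/ler_addgt0Pr => e e0.
have y1 : 0 < complex.Re y + 1 by rewrite ltr_wpDl.
(* The added 1 keeps the denominator positive when [y] vanishes. *)
have := le (complex.Re s + e / (complex.Re y + 1)).
rewrite ltrDl divr_gt0 // => /(_ isT)/le_trans; apply.
rewrite mulrDl lerD2l mulrAC ler_pdivrMr // ler_pM2l //.
by rewrite lerDl.
Qed.

Lemma CP_bound Psi a h k : CP A dot Psi ->
  `|dot (Psi a h) k| ^+ 2 <=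
  cnorm a ^+ 2 * dot (Psi 1 h) h * dot (Psi 1 k) k.
Proof.
move=> P; have [_ le] := CP_cs a h k P; apply: le_trans le _.
by rewrite ler_wpM2r ?CP_sq_le //; exact: CP_unit_pos.
Qed.

(** By [CP_bound], the whole map is controlled by its value at 1; with [CP_kerr], vectors matter
    only modulo the kernel of [Psi 1]. *)
Lemma CP_kerl Psi a h : CP A dot Psi -> Psi 1 h = 0 -> Psi a h = 0.
Proof.
move=> P h0; apply: (@dot_injl _ _ dot) => k; rewrite dot0l; apply/eqP.
rewrite -normr_eq0 -sqrf_eq0 eq_le exprn_ge0 // andbT.
by have := CP_bound a h k P; rewrite h0 dot0l mulr0 mul0r.
Qed.

Lemma CP_kerr Psi a h k : CP A dot Psi -> Psi 1 h = 0 -> dot (Psi a k) h = 0.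
Proof.
move=> P h0; have [/(congr1 Num.conj)] := CP_cs a k h P.
by rewrite conjCK (CP_kerl _ P h0) dot0l conjC0.
Qed.

Lemma CP_eq0 Psi : CP A dot Psi -> Psi 1 = 0 -> forall a, Psi a = 0.
Proof.
by move=> P e a; apply/lfunP => h; rewrite (CP_kerl _ P) ?e zero_lfunE.
Qed.

(** One direction is Cauchy-Schwarz at [a = 1]. For the other, [CP_bound] with [k := Psi a h] bounds
    the fourth power of the norm of [k], and the square of this norm cancels. *)
Lemma CP_contractive Psi : CP A dot Psi ->
  contractive dot Psi <-> forall h, dot (Psi 1 h) h <= dot h h.
Proof.
move=> P; split=> [c h|c a h].
  apply: (@le_trans _ _ `|dot (Psi 1 h) h|).
    by rewrite ger0_norm //; exact: CP_unit_pos.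
  apply: le_trans (_ : _ <= hnorm dot (Psi 1 h) * hnorm dot h) _.
    have /leifP/= := CauchySchwarz_sqrt dot (Psi 1 h) h.
    by case: ifP => _ => [/eqP->|/ltW].
  have := c 1 h; rewrite cnorm1 mul1r => le.
  rewrite -[leRHS]sqrtCK expr2 ler_wpM2r //.
  exact: sqrt_dnorm_ge0.
have n0 (x : H) : 0 <= hnorm dot x := sqrt_dnorm_ge0 dot x.
rewrite -(ler_pXn2r (ltn0Sn 1)) ?nnegrE ?mulr_ge0 ?cnorm_ge0 //.
rewrite exprMn !sqrtCK; set k := Psi a h.
have [k0|kn0] := eqVneq (dot k k) 0.
  by rewrite k0 mulr_ge0 ?dnorm_ge0 // exprn_ge0 // cnorm_ge0.
have kp : 0 < dot k k by rewrite lt_def kn0 dnorm_ge0.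
rewrite -(ler_pM2r kp).
have -> : dot k k * dot k k = `|dot k k| ^+ 2 by rewrite gtr0_norm // expr2.
have a0 : 0 <= cnorm a ^+ 2 by rewrite exprn_ge0 ?cnorm_ge0.
apply: le_trans (CP_bound a h k P) _; apply: ler_pM => //.
- by rewrite mulr_ge0 //; exact: CP_unit_pos.
- exact: CP_unit_pos.
- by rewrite ler_wpM2l.
Qed.

Lemma CP_zero : CP A dot (fun=> 0).
Proof.
apply/CPP; split=> [c a b|m w h]; first by rewrite scaler0 addr0.
by do 2!apply: sumr_ge0 => ? _; rewrite zero_lfunE dot0l.
Qed.

Lemma CP_addmap Phi Psi : CP A dot Phi -> CP A dot Psi ->
  CP A dot (fun a => Phi a + Psi a).
Proof.
move=> /CPP[l p] /CPP[l' p']; apply/CPP; split=> [c a b|m w h].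
  by rewrite l l' scalerDr addrACA.
have := addr_ge0 (p m w h) (p' m w h); rewrite -big_split /=.
congr (0 <= _); apply: eq_bigr => i _; rewrite -big_split /=.
by apply: eq_bigr => j _; rewrite add_lfunE dotDl.
Qed.

Lemma CP_scalemap (c : R[i]) Psi : 0 <= c -> CP A dot Psi ->
  CP A dot (fun a => c *: Psi a).
Proof.
move=> c0 /CPP[l p]; apply/CPP; split=> [d a b|m w h].
  by rewrite l scalerDr !scalerA mulrC.
have := mulr_ge0 c0 (p m w h); rewrite big_distrr /=.
congr (0 <= _); apply: eq_bigr => i _; rewrite big_distrr /=.
by apply: eq_bigr => j _; rewrite scale_lfunE dotZl.
Qed.

Lemma CP_summap (I : Type) (s : seq I) (P : pred I) (F : I -> A -> 'End(H)) :
  (forall i, P i -> CP A dot (F i)) ->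
  CP A dot (fun a => \sum_(i <- s | P i) F i a).
Proof.
move=> cp; elim: s => [|i s IH].
  have -> : (fun a => \sum_(i <- [::] | P i) F i a) = (fun=> 0).
    by apply/funext => a; rewrite big_nil.
  exact: CP_zero.
have [Pi|Pi] := boolP (P i).
  have -> : (fun a => \sum_(j <- i :: s | P j) F j a) =
            (fun a => F i a + \sum_(j <- s | P j) F j a).
    by apply/funext => a; rewrite big_cons Pi.
  by apply: CP_addmap => //; exact: cp.
have -> // : (fun a => \sum_(j <- i :: s | P j) F j a) =
             (fun a => \sum_(j <- s | P j) F j a).
by apply/funext => a; rewrite big_cons (negbTE Pi).
Qed.

Lemma CP_Ad T Psi : CP A dot Psi -> CP A dot (fun a => Ad dot T (Psi a)).
Proof.
move=> /CPP[l p]; apply/CPP; split=> [c a b|m w h]; first by rewrite l AdD AdZ.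
have := p m w (fun i => T (h i)).
by congr (0 <= _); do 2!apply: eq_bigr => ? _; rewrite AdE.
Qed.

End CompletelyPositiveMaps.

(** * Pure maps and C*-extreme points *)

Section PureMaps.
Variables (R : realType) (A : cstarAlgType R).
Variables (H : vectType R[i]) (dot : {dot H for @Num.conj R[i]}).
Implicit Types (Phi Psi Theta : A -> 'End(H)) (a b : A) (h k : H).
Implicit Types (T X : 'End(H)).

Definition pure Psi := CP A dot Psi /\
  forall Phi Theta, CP A dot Phi -> CP A dot Theta ->
    (forall a, Psi a = Phi a + Theta a) ->
  exists2 t : R[i], 0 <= t & forall a, Phi a = t *: Psi a.

Lemma CP_Ad_id Psi X : CP A dot Psi -> (forall h, Psi 1 (X h) = Psi 1 h) ->
  forall a, Ad dot X (Psi a) = Psi a.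
Proof.
move=> P e a.
have ker h : Psi 1 (X h - h) = 0 by rewrite lfunB e subrr.
apply: (@lfun_dot_eq _ _ dot) => h k; rewrite AdE.
have -> : Psi a (X h) = Psi a h.
  by apply/eqP; rewrite -subr_eq0 -lfunB (CP_kerl _ P (ker h)).
by apply/eqP; rewrite -subr_eq0 -dotBr (CP_kerr _ _ P (ker k)).
Qed.

Lemma CP_addl_ker Phi Theta h : CP A dot Phi -> CP A dot Theta ->
  dot ((Phi 1 + Theta 1) h) h = 0 -> Phi 1 h = 0.
Proof.
move=> p q; rewrite add_lfunE dotDl => /eqP.
have p1 := CP_unit_pos p; have q1 := CP_unit_pos q.
by rewrite paddr_eq0 // => /andP[/eqP/(op_pos_eq0 p1)].
Qed.

Lemma pure_zero : pure (fun=> 0).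
Proof.
split=> [|Phi Theta p q e]; first exact: CP_zero.
exists 0 => // a; rewrite scaler0; apply: (CP_eq0 p).
apply/lfunP => h; rewrite zero_lfunE; apply: (CP_addl_ker p q).
by rewrite -e zero_lfunE dot0l.
Qed.

Lemma pure_projection_extreme Psi : pure Psi -> (Psi 1 \o Psi 1)%VF = Psi 1 ->
  cstar_extreme A dot Psi.
Proof.
move=> [cp pur]; set P := Psi 1 => PP.
have Ppos : op_pos dot P := CP_unit_pos cp.
have PA : adj dot P = P by exact: op_pos_adj.
have PPE h : P (P h) = P h.
  by rewrite -[RHS](congr1 (fun X : 'End(H) => X h) PP) comp_lfunE.
split.
  split=> //; apply/CP_contractive => // h.
  rewrite -subr_ge0 -/P; have := dnorm_ge0 dot (h - P h).
  congr (0 <= _); rewrite !(dotBl, dotBr) [dot (P h) (P h)]adjP PA PPE.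
  by rewrite [dot (P h) h]adjP PA subrr subr0.
move=> n T Phi_ ccp inv [_ T1 comb].
have cpj j : CP A dot (fun a => Ad dot (T j) (Phi_ j a)).
  by apply: CP_Ad; case: (ccp j).
have ex j : exists t, 0 <= t /\
    forall a, Ad dot (T j) (Phi_ j a) = t *: Psi a.
  have [||t t0 tE] := pur _
    (fun a => \sum_(i | i != j) Ad dot (T i) (Phi_ i a)) (cpj j).
  - by apply: CP_summap => i _; exact: cpj.
  - by move=> a; rewrite comb (bigD1 j).
  - by exists t.
have [t tP] := choice ex.
suff U j : exists U, op_unitary dot U /\ forall a, Phi_ j a = Ad dot U (Psi a).
  by have [U' ?] := choice U; exists U'.
have [S [ST TS]] := inv j; have [t0 tE] := tP j.
have STE h : S (T j h) = h by rewrite -comp_lfunE ST id_lfunE.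
have PhiE a : Phi_ j a = t j *: Ad dot S (Psi a).
  by rewrite -AdZ -tE Ad_comp TS Ad1.
have [P0|/eqP Pn0] := pselect (P = 0).
  exists \1%VF; split; first by split; rewrite adj1 comp_lfun1l.
  by move=> a; rewrite PhiE (CP_eq0 cp P0) !Ad0 scaler0.
(* The decomposition at 1 reads [(\sum_i t i) *: P = P], and [P] is nonzero. *)
have sum_t : \sum_i t i = 1.
  apply/eqP; rewrite -subr_eq0; apply/negPn/negP => n0.
  move/eqP: Pn0; apply; apply: (scalerI n0).
  rewrite scaler0 scalerBl scale1r scaler_suml {2}/P comb.
  by rewrite -sumrB big1 // => i _; rewrite (tP i).2 subrr.
(* Contractivity of [Phi_ i] at [T i h] makes [T_i^* T_i - t_i P] positive. *)
have B0 i h : 0 <= dot (T i h) (T i h) - t i * dot (P h) h.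
  have [cpi /CP_contractive/(_ (T i h))] := ccp i.
  rewrite -AdE (tP i).2 scale_lfunE dotZl => le.
  by rewrite subr_ge0 le.
have TTP h : adj dot (T j) (T j (P h)) = t j *: P h.
  pose B := (adj dot (T j) \o T j)%VF - t j *: P.
  have BE x y : dot (B x) y = dot (T j x) (T j y) - t j * dot (P x) y.
    rewrite add_lfunE opp_lfunE scale_lfunE comp_lfunE dotBl dotZl.
    by rewrite adjPr.
  have Bp : op_pos dot B by move=> x; rewrite BE.
  (* On the range of [P] these nonnegative terms sum to zero, hence each vanishes; a positive
     operator kills any vector at which its form is zero. *)
  have : \sum_i (dot (T i (P h)) (T i (P h)) - t i * dot (P (P h)) (P h)) = 0.
    rewrite sumrB -big_distrl /= sum_t mul1r PPE.
    apply/eqP; rewrite subr_eq0; apply/eqP.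
    have /lfunP/(_ (P h))/(congr1 (dot^~ (P h))) := T1.
    rewrite id_lfunE sum_lfunE dot_suml => <-; apply: eq_bigr => i _.
    by rewrite comp_lfunE [in RHS]dotC -adjP -dotC.
  move=> /psumr_eq0P/(_ j isT) B0j.
  have /(op_pos_eq0 Bp) : dot (B (P h)) (P h) = 0 by rewrite BE B0j.
  rewrite add_lfunE opp_lfunE scale_lfunE comp_lfunE PPE => /eqP.
  by rewrite subr_eq0 => /eqP.
have tn0 : t j != 0.
  apply: contra_neq Pn0 => tj0; apply/lfunP => h; rewrite zero_lfunE.
  rewrite -[LHS]STE [T j _](_ : _ = 0) ?linear0 //; apply: (@dot_eq0 _ _ dot).
  by rewrite adjP TTP tj0 scale0r dot0r.
have tp : 0 < t j by rewrite lt_def tn0.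
pose s := sqrtC (t j); have sp : 0 < s by rewrite sqrtC_gt0.
have sC : s^-1^* = s^-1 by apply/CrealP/ger0_real; rewrite invr_ge0 ltW.
have ss : s^-1 * s^-1 * t j = 1 by rewrite -invfM -expr2 sqrtCK mulVf.
pose V := s^-1 *: (T j \o P)%VF.
have VV : (adj dot V \o V)%VF = P.
  apply/lfunP => h; rewrite comp_lfunE /V adjZ sC adj_comp PA !scale_lfunE.
  rewrite !comp_lfunE !lfunZ TTP lfunZ PPE.
  by rewrite !scalerA mulrA ss scale1r.
have [W [W1 W2] WE] : exists2 W, op_unitary dot W & (W \o P)%VF = V.
  rewrite -VV; apply: unitary_extension; rewrite -comp_lfunA VV.
  by apply/lfunP => h; rewrite comp_lfunE !scale_lfunE !comp_lfunE PPE.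
(* Here [P W^* = s P S] with [s * s = t j]. As [Ad_P] fixes the values of [Psi], [Ad_{W^*}] maps
   them where [t_j Ad_S] does, that is, to [Phi_ j]. *)
exists (adj dot W); split; first by split; rewrite adjK.
have WPh h : P (adj dot W h) = s^-1 *: (t j *: P (S h)).
  have -> : P (adj dot W h) = adj dot V h.
    by rewrite -WE adj_comp PA comp_lfunE.
  rewrite /V adjZ sC scale_lfunE adj_comp comp_lfunE PA; congr (_ *: _).
  have PTT k : P (adj dot (T j) (T j k)) = t j *: P k.
    apply: (@dot_injl _ _ dot) => u; rewrite dotZl.
    rewrite [LHS]adjP PA -adjPr adjP TTP dotZr (CrealP (ger0_real t0)).
    by rewrite [dot (P k) u]adjP PA.
  by rewrite -PTT -[T j (S h)]comp_lfunE TS id_lfunE.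
move=> a; rewrite PhiE; apply: (@lfun_dot_eq _ _ dot) => h k.
rewrite AdE scale_lfunE dotZl AdE.
have cpr x y : dot (Psi a (P x)) (P y) = dot (Psi a x) y.
  by rewrite -AdE CP_Ad_id.
rewrite -[RHS]cpr !WPh -cpr.
rewrite !lfunZ !dotZl !dotZr sC (CrealP (ger0_real t0)).
rewrite -[t j in LHS]mul1r -{1}ss; ring.
Qed.

(** The factor is [Ad_Z] of [Psi], with [Z] a generalised inverse of [T]: its value at 1 is the
    projection [T Z], and applying [Ad_T] returns [Psi] because [Z T] is the identity modulo the
    kernel of [Psi 1]. A summand of the factor becomes a summand of [Psi] under [Ad_T], which
    transports purity. *)
Lemma pure_factor Psi : pure Psi -> exists T Phi,
  [/\ cstar_extreme A dot Phi, (adj dot T \o T)%VF = Psi 1 &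
      forall a, Psi a = Ad dot T (Phi a)].
Proof.
move=> [cp pur]; have [T TT] := op_pos_factor (CP_unit_pos cp).
have [Z [TZT TZadj]] := generalized_inverse dot T.
pose E := (T \o Z)%VF.
have TZTE h : T (Z (T h)) = T h.
  by rewrite -[RHS](congr1 (fun X : 'End(H) => X h) TZT) !comp_lfunE.
have cpZ : CP A dot (fun a => Ad dot Z (Psi a)) by exact: CP_Ad.
have Z1 : Ad dot Z (Psi 1) = E.
  rewrite /Ad -TT !comp_lfunA -adj_comp TZadj -comp_lfunA -/E.
  by rewrite /E comp_lfunA TZT.
have EE : (E \o E)%VF = E by rewrite /E comp_lfunA TZT.
have TZ a : Psi a = Ad dot T (Ad dot Z (Psi a)).
  rewrite Ad_comp CP_Ad_id // => h.
  by rewrite -TT !comp_lfunE TZTE.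
exists T, (fun a => Ad dot Z (Psi a)); split=> //.
apply: pure_projection_extreme; last by rewrite Z1.
split=> // Phi Theta p q e.
have [||a|t t0 tE] := pur (fun a => Ad dot T (Phi a)) (fun a => Ad dot T (Theta a)).
- exact: CP_Ad.
- exact: CP_Ad.
- by rewrite -AdD -e -TZ.
(* [Ad_Z] recovers [Phi] from [Ad_T] of [Phi], since [Phi 1] vanishes on the kernel of the
   projection [E]. *)
exists t => // a; rewrite -AdZ -tE Ad_comp CP_Ad_id // => h.
apply/eqP; rewrite -subr_eq0 -lfunB; apply/eqP.
apply: (CP_addl_ker p q); rewrite -e Z1 lfunB.
by rewrite -[E (_ (h))]comp_lfunE EE subrr dot0l.
Qed.

End PureMaps.

(** * Extreme real-linear functionals through sublinear support functions *)

Section ExtremeFunctionals.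
Variables (R : realType) (V : lmodType R[i]).
Implicit Types (q f g e : V -> R) (x y : V) (r t : R).

Definition real_linear f := (forall x y, f (x + y) = f x + f y) /\
  (forall r x, f (r%:C%C *: x) = r * f x).

(** Only one inequality of positive homogeneity is asked for, which is easy to check on infima;
    scaling back by the inverse gives equality. *)
Definition sublinear q := (forall x y, q (x + y) <= q x + q y) /\
  (forall r x, 0 < r -> q (r%:C%C *: x) <= r * q x).

Lemma real_linearN f x : real_linear f -> f (- x) = - f x.
Proof. by case=> _ /(_ (-1) x); rewrite rmorphN1 scaleN1r mulN1r. Qed.

Lemma sublinear0 q : sublinear q -> q 0 = 0.
Proof.
case=> qD qZ; have := qD 0 0; have := qZ 2^-1 0.
rewrite invr_gt0 ltr0n scaler0 addr0 => /(_ isT); lra.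
Qed.

Lemma sublinear_scale q r x : sublinear q -> 0 < r -> q (r%:C%C *: x) = r * q x.
Proof.
move=> sq r0; apply/le_anti; rewrite sq.2 //=.
rewrite -ler_pdivlMl //; apply: le_trans (sq.2 _ _ _); last by rewrite invr_gt0.
by rewrite scalerA -rmorphM /= mulVf ?gt_eqF // scale1r.
Qed.

Lemma sublinearN q x : sublinear q -> - q (- x) <= q x.
Proof.
move=> sq; have := sq.1 x (- x); rewrite subrr sublinear0 //; lra.
Qed.

Lemma sublinear_odd q : sublinear q -> (forall x, q (- x) <= - q x) ->
  real_linear q.
Proof.
move=> sq odd; have qN x : q (- x) = - q x.
  by apply/le_anti; rewrite odd lerNl sublinearN.
split=> [x y|r x].
  apply/le_anti; rewrite sq.1 /= -[q (x + y)]opprK -qN opprD lerNr opprD.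
  by rewrite -!qN; exact: sq.1.
have [r0|r0|->] := ltgtP r 0; last by rewrite scale0r sublinear0 // mul0r.
  rewrite -[r]opprK rmorphN scaleNr qN sublinear_scale ?oppr_gt0 //.
  by rewrite -mulNr.
by rewrite sublinear_scale.
Qed.

Lemma le_mul_inf (S : set R) (c z : R) : S !=set0 -> 0 <= c ->
  (forall s, S s -> z <= c * s) -> z <= c * inf S.
Proof.
move=> [s0 Ss0] c0 zle; have [cz|cn0] := eqVneq c 0.
  by have := zle _ Ss0; rewrite cz !mul0r.
have cp : 0 < c by rewrite lt_def cn0.
rewrite -ler_pdivrMl //; apply: lb_le_inf; first by exists s0.
by move=> s /zle; rewrite ler_pdivrMl.
Qed.

Variables (K : set (V -> R)) (u : V).
Hypothesis K_linear : forall f, K f -> real_linear f.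
Hypothesis K_ge0 : forall f, K f -> 0 <= f u.

(* [q] is the support function of a face of the set of states [f u = 1]. *)
Definition face_support q := [/\ sublinear q, q u <= 1, q (- u) <= - 1 &
  forall f g, K f -> K g -> (forall x, f x + g x <= q x) ->
  forall x, f x <= f u * q x].

(* The support function of the set of maximisers of [y] in the face of [q]. *)
Definition expose q y x : R :=
  inf [set q (x + t%:C%C *: y) - t * q y | t in [set t | 0 <= t]].

Section Expose.
Variables (q : V -> R) (y : V).
Hypothesis sq : sublinear q.

Lemma expose_nonempty x :
  [set q (x + t%:C%C *: y) - t * q y | t in [set t | 0 <= t]] !=set0.
Proof. by exists (q (x + 0%:C%C *: y) - 0 * q y); exists 0 => /=. Qed.

Lemma expose_le x t : 0 <= t -> expose q y x <= q (x + t%:C%C *: y) - t * q y.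
Proof.
move=> t0; apply: ge_inf; last by exists t.
exists (- q (- x)) => _ [s /= s0 <-].
have := sq.1 (x + s%:C%C *: y) (- x); rewrite addrAC subrr add0r.
have [->|sn0] := eqVneq s 0.
  by rewrite scale0r sublinear0 // addr0 mul0r; lra.
by rewrite sublinear_scale ?lt_def ?sn0 //; lra.
Qed.

Lemma expose_ge x c : (forall t, 0 <= t -> c <= q (x + t%:C%C *: y) - t * q y) ->
  c <= expose q y x.
Proof.
by move=> le; apply: lb_le_inf (expose_nonempty x) _ => _ [t /= t0 <-]; exact: le.
Qed.

Lemma expose_le_id x : expose q y x <= q x.
Proof.
by apply: le_trans (expose_le x (lexx 0)) _; rewrite scale0r addr0 mul0r subr0.
Qed.

Lemma expose_opp : expose q y (- y) <= - q y.
Proof.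
apply: le_trans (expose_le (- y) ler01) _.
by rewrite scale1r addNr sublinear0 // mul1r sub0r.
Qed.

Lemma expose_sublinear : sublinear (expose q y).
Proof.
split=> [x x'|r x r0].
  rewrite -lerBlDr; apply: expose_ge => t t0.
  rewrite lerBlDr [leRHS]addrC -lerBlDr; apply: expose_ge => t' t'0; rewrite lerBlDr.
  apply: le_trans (expose_le _ (addr_ge0 t0 t'0)) _.
  have := sq.1 (x + t%:C%C *: y) (x' + t'%:C%C *: y).
  by rewrite addrACA -scalerDl -rmorphD /=; lra.
rewrite mulrC -ler_pdivrMr // mulrC; apply: expose_ge => t t0.
rewrite ler_pdivrMl //; apply: le_trans (expose_le _ (mulr_ge0 (ltW r0) t0)) _.
rewrite rmorphM /= -scalerA -scalerDr sublinear_scale //.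
by rewrite mulrBr mulrA.
Qed.

(** If [f + g] lies below [expose q y], its value at [y] is at least [q y], and [f u + g u = 1]. The
    face property of [q] bounds [f y] by [f u * q y], and likewise [g y], so both bounds are
    attained; this gives the inequality for each [t] in the infimum. *)
Lemma expose_face : face_support q -> face_support (expose q y).
Proof.
move=> [_ q1 qN1 face]; split.
- exact: expose_sublinear.
- exact: le_trans (expose_le_id _) _.
- exact: le_trans (expose_le_id _) _.
move=> f g Kf Kg fg x.
have fgq z : f z + g z <= q z by apply: le_trans (fg z) (expose_le_id z).
have gfq z : g z + f z <= q z by rewrite addrC.
have fq := face f g Kf Kg fgq; have gq := face g f Kg Kf gfq.
have lf := K_linear Kf; have lg := K_linear Kg.
have fu := fgq u; have := fgq (- u).
rewrite (real_linearN _ lf) (real_linearN _ lg) => fuN.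
have := fg (- y); rewrite (real_linearN _ lf) (real_linearN _ lg) => fgy.
have yN := expose_opp.
have e1 : f u + g u = 1 by lra.
have fy : f y = f u * q y.
  apply/le_anti; rewrite fq /=; have := gq y.
  have -> : g u = 1 - f u by lra.
  rewrite mulrBl mul1r; lra.
apply: le_mul_inf (expose_nonempty x) (K_ge0 Kf) _ => _ [t /= t0 <-].
have := fq (x + t%:C%C *: y); rewrite lf.1 lf.2 fy mulrBr mulrCA; lra.
Qed.

End Expose.

(** The pointwise infimum works; it is finite because every member is at least [- q0 (- x)] at [x].
    Subadditivity uses that the smaller of two members bounds both terms. *)
Lemma chain_face (C : set (V -> R)) q0 q1 : C q1 ->
  (forall q, C q -> face_support q /\ forall x, q x <= q0 x) ->
  (forall q q', C q -> C q' ->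
    (forall x, q x <= q' x) \/ (forall x, q' x <= q x)) ->
  exists e, face_support e /\ forall q, C q -> forall x, e x <= q x.
Proof.
move=> Cq1 CP tot; pose e x := inf [set q x | q in C].
have ne x : [set q x | q in C] !=set0 by exists (q1 x), q1.
have e_le q x : C q -> e x <= q x.
  move=> Cq; apply: ge_inf; last by exists q.
  exists (- q0 (- x)) => _ [q' Cq' <-].
  have [[sq' _ _ _] le] := CP _ Cq'.
  by apply: le_trans (sublinearN x sq'); rewrite lerN2.
have e_ge x c : (forall q, C q -> c <= q x) -> c <= e x.
  by move=> le; apply: lb_le_inf (ne x) _ => _ [q Cq <-]; exact: le.
exists e; split; last by move=> q Cq x; exact: e_le.
have [[_ q1u q1N _] _] := CP _ Cq1.
split.
- split=> [x x'|r x r0].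
    rewrite -lerBlDr; apply: (e_ge _ _) => q Cq.
    rewrite lerBlDr [leRHS]addrC -lerBlDr; apply: (e_ge _ _) => q' Cq'; rewrite lerBlDr.
    have [[sq _ _ _] _] := CP _ Cq; have [[sq' _ _ _] _] := CP _ Cq'.
    have [le|le] := tot _ _ Cq Cq'.
      apply: le_trans (e_le _ (x + x') Cq) _; apply: le_trans (sq.1 _ _) _.
      by rewrite [leLHS]addrC lerD.
    apply: le_trans (e_le _ (x + x') Cq') _; apply: le_trans (sq'.1 _ _) _.
    by rewrite [leLHS]addrC lerD.
  apply: le_mul_inf (ne x) (ltW r0) _ => _ [q Cq <-].
  have [[sq _ _ _] _] := CP _ Cq.
  by apply: le_trans (e_le _ _ Cq) (sq.2 _ _ r0).
- exact: le_trans (e_le _ _ Cq1) _.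
- exact: le_trans (e_le _ _ Cq1) _.
move=> f g Kf Kg fg x; apply: le_mul_inf (ne x) (K_ge0 Kf) _ => _ [q Cq <-].
have [[_ _ _ face] _] := CP _ Cq; apply: (face f g) => // z.
exact: le_trans (fg z) (e_le _ _ Cq).
Qed.

(** A minimal support function, given by Zorn's lemma for the reversed pointwise order, equals all
    of its own [expose]. Hence it is odd, that is, linear: the face is a point. *)
Lemma minimal_face q0 : face_support q0 -> exists e,
  [/\ face_support e, real_linear e & forall x, e x <= q0 x].
Proof.
move=> f0; pose P q := face_support q /\ forall x, q x <= q0 x.
pose T := {q : V -> R | P q}.
pose le (s t : T) := `[< forall x, sval t x <= sval s x >].
have [||||[e [fe le0]] emin] := @Zorn T le.
- by move=> s; apply/asboolP.
- move=> r s t /asboolP rs /asboolP st; apply/asboolP => x.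
  exact: le_trans (st x) (rs x).
- move=> [s sP] [t tP] /asboolP st /asboolP ts; apply: eq_exist.
  by apply/funext => x; apply/le_anti; rewrite st ts.
- move=> C tot; have [[[q1 Pq1] Cq1]|Cn0] := pselect (C !=set0); last first.
    by exists (exist _ q0 (conj f0 (fun=> lexx _))) => s Cs; case: Cn0; exists s.
  pose C' := [set sval s | s in C].
  have tot' q q' : C' q -> C' q' ->
      (forall x, q x <= q' x) \/ (forall x, q' x <= q x).
    move=> [s Cs <-] [t Ct <-].
    by have [/asboolP|/asboolP] := tot s t Cs Ct; [right|left].
  have [||e [fe ele]] := @chain_face C' q0 q1 _ _ tot'.
  - by exists (exist _ q1 Pq1).
  - by move=> _ [[q Pq] _ <-].
  have le0 x : e x <= q0 x.
    by apply: le_trans (ele q1 _ x) (Pq1.2 x); exists (exist _ q1 Pq1).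
  exists (exist _ e (conj fe le0)) => s Cs; apply/asboolP => x.
  by apply: ele; exists s.
have [sub _ _ _] := (fe).
exists e; split=> //; apply: sublinear_odd => // y.
have fE := @expose_face e y sub fe.
have lE x : expose e y x <= q0 x by apply: le_trans (@expose_le_id e y sub x) (le0 x).
have := emin (exist _ _ (conj fE lE)); set b := le _ _ => eE.
have {}eE : expose e y = e.
  suff /eE/(congr1 sval) : b by [].
  by apply/asboolP => x /=; exact: expose_le_id.
by have := @expose_opp e y sub; rewrite eE.
Qed.

(** Minimising below [expose q y] keeps [e] among the maximisers of [y]. The face property gives
    [f <= f u * e], and linearity at [- x] the reverse. *)
Lemma extreme_functional q y : face_support q -> exists e,
  [/\ real_linear e, forall x, e x <= q x, q y <= e y &
   forall f g, K f -> K g -> (forall x, e x = f x + g x) ->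
     forall x, f x = f u * e x].
Proof.
move=> fq; have sq : sublinear q by case: fq.
have [e [[_ _ _ face] le lee]] := minimal_face (@expose_face q y sq fq).
exists e; split=> //.
- by move=> x; apply: le_trans (lee x) (@expose_le_id q y sq x).
- by rewrite -lerN2 -real_linearN // (le_trans (lee _)) // expose_opp.
move=> f g Kf Kg eE; have {}face := face f g Kf Kg.
have fle x : f x <= f u * e x by apply: face => z; rewrite eE.
move=> x; apply/le_anti; rewrite fle /=; have := fle (- x).
by rewrite !real_linearN //; [rewrite mulrN lerN2|exact: K_linear].
Qed.

End ExtremeFunctionals.

(* Greedy choice of the next vector at an obtuse angle with the current sum;
   dividing by [k], a barycentre of [k] vectors has squared norm at most [M / k]. *)
Lemma greedy_sum (R : realDomainType) (X : Type) (L : finType) (E : set X)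
    (v : X -> L -> R) (M : R) :
  (forall c : L -> R, exists2 e, E e & \sum_l c l * v e l <= 0) ->
  (forall e, E e -> \sum_l v e l ^+ 2 <= M) ->
  forall k, exists2 s : 'I_k -> X, (forall i, E (s i)) &
    \sum_l (\sum_i v (s i) l) ^+ 2 <= M *+ k.
Proof.
move=> obt bnd; elim=> [|k [s Es sM]].
  have [e Ee _] := obt (fun=> 0); exists (fun=> e) => //.
  by rewrite big1 // => l _; rewrite big_ord0 expr0n.
have [e Ee le0] := obt (fun l => \sum_i v (s i) l).
exists (fun i => if unlift ord0 i is Some j then s j else e).
  by move=> i; case: unliftP.
under eq_bigr do (rewrite big_ord_recl unlift_none;
  under eq_bigr do rewrite liftK; rewrite sqrrD).
rewrite !big_split /= mulrS; have := bnd e Ee.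
set a := \sum_l v e l ^+ 2; set b := \sum_l (\sum_i _) ^+ 2 in sM *.
move=> aM; apply: lerD sM; rewrite -[leRHS]addr0; apply: lerD aM _.
have {}le0 : \sum_l v e l * (\sum_i v (s i) l) <= 0.
  apply: le_trans le0; rewrite le_eqVlt; apply/orP; left; apply/eqP.
  by apply: eq_bigr => l _; rewrite mulrC.
by rewrite -[leRHS]addr0 lerD.
Qed.

(** * Complex-linear functionals from their real parts *)

Section Complexification.
Variables (R : realType) (V : lmodType R[i]) (e : V -> R).
Hypothesis le : real_linear e.

(** For real-linear [e], the unique complex-linear functional with real part [e]. *)
Definition complexification (x : V) : R[i] :=
  (e x)%:C%C - 'i * (e ('i *: x))%:C%C.

Lemma Re_complexification x : complex.Re (complexification x) = e x.
Proof.
by rewrite /complexification /= !(mul0r, mul1r, mulr0, subr0, oppr0, sub0r, addr0).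
Qed.

Lemma complexification_linear : linear (complexification : V -> R[i]^o).
Proof.
move=> c x y; have [eD eZ] := le; rewrite /complexification.
have [s [t ->]] : exists s t : R, c = s%:C%C + 'i * t%:C%C.
  case: c => s t; exists s, t; apply/eqP; rewrite eq_complex /=.
  by rewrite !(mul0r, mul1r, mulr0, subr0, oppr0, sub0r, addr0, add0r) !eqxx.
have ii : 'i * 'i = -1 :> R[i] by rewrite -expr2 sqrCi.
have -> : e ((s%:C%C + 'i * t%:C%C) *: x + y) = s * e x + t * e ('i *: x) + e y.
  by rewrite eD scalerDl eD eZ [X in e (X *: x)]mulrC -scalerA eZ.
have -> : e ('i *: ((s%:C%C + 'i * t%:C%C) *: x + y)) =
    s * e ('i *: x) - t * e x + e ('i *: y).
  rewrite scalerDr eD scalerDl scalerDr eD; congr (_ + _ + _).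
    by rewrite scalerA mulrC -scalerA eZ.
  by rewrite scalerA mulrA ii mulN1r scaleNr (real_linearN _ le) eZ.
transitivity ((s%:C%C + 'i * t%:C%C) * ((e x)%:C%C - 'i * (e ('i *: x))%:C%C)
  + ((e y)%:C%C - 'i * (e ('i *: y))%:C%C)); last by [].
transitivity (s%:C%C * (e x)%:C%C + 'i * t%:C%C * (e x)%:C%C
  - 'i * s%:C%C * (e ('i *: x))%:C%C
  - ('i * 'i) * t%:C%C * (e ('i *: x))%:C%C
  + ((e y)%:C%C - 'i * (e ('i *: y))%:C%C)); last by ring.
by rewrite ii; ring.
Qed.

End Complexification.

(** * The correspondence between completely positive maps and positive functionals on [M_n(A)] *)

Section Functionals.
Variables (R : realType) (A : cstarAlgType R).
Variables (H : vectType R[i]) (dot : {dot H for @Num.conj R[i]}).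
Variables (n : nat) (b : 'I_n -> H).
Hypothesis b_basis : orthonormal_basis dot b.
Implicit Types (Phi Psi Theta : A -> 'End(H)) (a : A) (h k : H).

(* [M_n(A)]; the type ['M[A]_n] is a module over [A], not over [R[i]]. *)
Definition entries := {ffun 'I_n * 'I_n -> A}.
Implicit Types (x y : entries).

Definition cp_functional Psi (x : entries) : R :=
  complex.Re (\sum_i \sum_j dot (Psi (x (i, j)) (b j)) (b i)).

Definition unit_entries : entries :=
  [ffun p => if p.1 == p.2 then 1 else 0].

Definition sq_entries (w : 'I_n -> A) : entries :=
  [ffun p => star (w p.1) * w p.2].

Definition entry i j a : entries := [ffun p => if p == (i, j) then a else 0].

(** The trace of [Psi 1]; value 1 is the normalisation of states. *)
Definition cp_trace Psi : R := complex.Re (\sum_i dot (Psi 1 (b i)) (b i)).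

Lemma cp_functional_linear Psi : CP A dot Psi -> real_linear (cp_functional Psi).
Proof.
move=> P; split=> [x y|r x].
  rewrite /cp_functional -Re_add -big_split /=; congr complex.Re.
  apply: eq_bigr => i _; rewrite -big_split /=; apply: eq_bigr => j _.
  by rewrite ffunE (CP_add _ _ P) add_lfunE dotDl.
rewrite /cp_functional -Re_realM big_distrr /=; congr complex.Re.
apply: eq_bigr => i _; rewrite big_distrr /=; apply: eq_bigr => j _.
by rewrite ffunE (CP_scale _ _ P) scale_lfunE dotZl.
Qed.

Lemma cp_functional_unit Psi : CP A dot Psi ->
  cp_functional Psi unit_entries = cp_trace Psi.
Proof.
move=> P; congr complex.Re; apply: eq_bigr => i _.
rewrite (bigD1 i) //= ffunE eqxx big1 ?addr0 // => j /negbTE ji.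
by rewrite ffunE /= eq_sym ji (CP_0 P) zero_lfunE dot0l.
Qed.

Lemma cp_functional_sq Psi w : CP A dot Psi ->
  0 <= cp_functional Psi (sq_entries w).
Proof.
move=> /CPP[_ /(_ n w b)] p; apply: Re_ge0.
by under eq_bigr do under eq_bigr do rewrite ffunE.
Qed.

(** The real part alone must record that the complex functional is real on squares; the
    reconstruction of a map relies on it. *)
Lemma cp_functional_isq Psi w : CP A dot Psi ->
  cp_functional Psi ('i *: sq_entries w) = 0.
Proof.
move=> P; have /CPP[_ /(_ n w b)] := P; set z := \sum_i _ => z0.
rewrite /cp_functional [X in complex.Re X](_ : _ = 'i * z).
  by rewrite (ge0_ReE z0) /= !(mul0r, mul1r, mulr0, subr0, oppr0, sub0r, addr0).
rewrite /z big_distrr /=; apply: eq_bigr => i _.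
rewrite big_distrr /=; apply: eq_bigr => j _.
by rewrite !ffunE (CP_scale _ _ P) scale_lfunE dotZl.
Qed.

Lemma cp_functional_entry Psi i j a : CP A dot Psi ->
  cp_functional Psi (entry i j a) = complex.Re (dot (Psi a (b j)) (b i)).
Proof.
move=> P; congr complex.Re; rewrite (bigD1 i) //= (bigD1 j) //= ffunE eqxx.
rewrite !big1 ?addr0 // => [i' ni|j' nj].
  apply: big1 => j' _.
  by rewrite ffunE xpair_eqE (negbTE ni) (CP_0 P) zero_lfunE dot0l.
by rewrite ffunE xpair_eqE (negbTE nj) andbF (CP_0 P) zero_lfunE dot0l.
Qed.

Lemma lfun_basis_eq (X Y : 'End(H)) :
  (forall i j, dot (X (b j)) (b i) = dot (Y (b j)) (b i)) -> X = Y.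
Proof.
move=> e; have [_ bE] := b_basis; apply: (@lfun_dot_eq _ _ dot) => h k.
rewrite (bE h) (bE k) !lfun_sum !dot_suml; apply: eq_bigr => j _.
rewrite !dot_sumr; apply: eq_bigr => i _.
by rewrite !lfunZ !dotZl !dotZr e.
Qed.

Lemma cp_functional_scale_inj Psi Phi (t : R) : CP A dot Psi -> CP A dot Phi ->
  (forall x, cp_functional Phi x = t * cp_functional Psi x) ->
  forall a, Phi a = t%:C%C *: Psi a.
Proof.
move=> P Q e a; apply: lfun_basis_eq => i j.
rewrite scale_lfunE dotZl [LHS]complex_ReE [in RHS](complex_ReE (dot _ _)).
have re c : complex.Re (dot (Phi c (b j)) (b i)) =
            t * complex.Re (dot (Psi c (b j)) (b i)).
  by rewrite -!cp_functional_entry.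
rewrite -!dotZl -!scale_lfunE -(CP_scale _ _ P) -(CP_scale _ _ Q) !re.
by rewrite !rmorphM /=; ring.
Qed.

Lemma cp_trace_le Psi i : CP A dot Psi ->
  dot (Psi 1 (b i)) (b i) <= (cp_trace Psi)%:C%C.
Proof.
move=> P; have p := CP_unit_pos P.
rewrite -ge0_ReE ?sumr_ge0 // (bigD1 i) //= lerDl sumr_ge0 //.
Qed.

Lemma cp_trace_ge0 Psi : CP A dot Psi -> 0 <= cp_trace Psi.
Proof.
by move=> P; apply/Re_ge0/sumr_ge0 => i _; exact: CP_unit_pos.
Qed.

Lemma cp_entry_bound Psi a i j : CP A dot Psi ->
  `|dot (Psi a (b j)) (b i)| <= cnorm a * (cp_trace Psi)%:C%C.
Proof.
move=> P; have t0 : 0 <= (cp_trace Psi)%:C%C by rewrite ler0c cp_trace_ge0.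
rewrite -(ler_pXn2r (ltn0Sn 1)) ?nnegrE ?mulr_ge0 ?cnorm_ge0 //.
apply: le_trans (CP_bound a (b j) (b i) P) _.
rewrite exprMn -mulrA ler_wpM2l ?exprn_ge0 ?cnorm_ge0 // expr2.
by rewrite ler_pM ?cp_trace_le //; exact: CP_unit_pos.
Qed.

Definition entries_norm x : R :=
  complex.Re (\sum_(i < n) \sum_(j < n) cnorm (x (i, j))).

Lemma cp_functional_bound Psi x : CP A dot Psi ->
  cp_functional Psi x <= cp_trace Psi * entries_norm x.
Proof.
move=> P; rewrite /cp_functional /entries_norm -Re_realM !Re_sum ?big_distrr /=.
rewrite Re_sum; apply: ler_sum => i _; rewrite Re_sum big_distrr Re_sum /=.
apply: ler_sum => j _; rewrite -lecR -[X in _ <= X]ge0_ReE.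
  by rewrite mulrC; apply: le_trans (Re_le_norm _) (cp_entry_bound _ _ _ P).
by rewrite mulr_ge0 ?cnorm_ge0 // ler0c cp_trace_ge0.
Qed.

Definition cp_functionals : set (entries -> R) :=
  [set cp_functional Psi | Psi in CP A dot].

(** * Reconstruction of a completely positive map from a functional *)

Section Reconstruction.
Variable e : entries -> R.
Hypothesis e_linear : real_linear e.
Hypothesis e_sq : forall w, 0 <= e (sq_entries w).
Hypothesis e_isq : forall w, e ('i *: sq_entries w) = 0.

Let g := complexification e.

Definition functional_map (a : A) : 'End(H) :=
  \sum_i \sum_j g (entry i j a) *: ketbra dot (b i) (b j).

Lemma functional_mapE a h k : dot (functional_map a h) k =
  \sum_i \sum_j g (entry i j a) * (dot h (b j) * dot (b i) k).
Proof.
rewrite /functional_map sum_lfunE dot_suml; apply: eq_bigr => i _.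
rewrite sum_lfunE dot_suml; apply: eq_bigr => j _.
by rewrite scale_lfunE ketbraE !dotZl.
Qed.

Lemma functional_map_basis a i j :
  dot (functional_map a (b j)) (b i) = g (entry i j a).
Proof.
have [bo _] := b_basis.
rewrite functional_mapE (bigD1 i) //= (bigD1 j) //= !bo !eqxx !mulr1.
rewrite !big1 ?addr0 // => [i' ni|j' nj].
  by apply: big1 => j' _; rewrite !bo (negbTE ni) !mulr0.
by rewrite !bo eq_sym (negbTE nj) mul0r mulr0.
Qed.

Lemma entries_sum x : x = \sum_i \sum_j entry i j (x (i, j)).
Proof.
apply/ffunP => -[k l]; rewrite sum_ffunE (bigD1 k) //= sum_ffunE (bigD1 l) //=.
rewrite ffunE eqxx !big1 ?addr0 // => [i ni|j nj].
  rewrite sum_ffunE; apply: big1 => j _.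
  by rewrite ffunE xpair_eqE eq_sym (negbTE ni).
by rewrite ffunE xpair_eqE [l == j]eq_sym (negbTE nj) andbF.
Qed.

Let gL := complexification_linear e_linear.

Lemma gZ c x : g (c *: x) = c * g x.
Proof.
have g0 : g 0 = 0.
  by have := gL (-1) 0 0; rewrite scaler0 addr0 scaleN1r addNr.
by have := gL c x 0; rewrite !addr0 -/g g0 addr0.
Qed.

Lemma gD x y : g (x + y) = g x + g y.
Proof. by have := gL 1 x y; rewrite !scale1r. Qed.

Lemma g_sum (I : Type) (s : seq I) (P : pred I) (F : I -> entries) :
  g (\sum_(i <- s | P i) F i) = \sum_(i <- s | P i) g (F i).
Proof.
by apply: (big_morph g gD); rewrite -(scale0r (0 : entries)) gZ mul0r.
Qed.

Lemma entry_linear i j : linear (entry i j).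
Proof.
move=> c a a'; apply/ffunP => p; rewrite !ffunE.
by case: ifP => // _; rewrite scaler0 addr0.
Qed.

Lemma functional_map_CP : CP A dot functional_map.
Proof.
apply/CPP; split=> [c a a'|m w h].
  apply: lfun_basis_eq => i j.
  rewrite add_lfunE scale_lfunE dotDl dotZl !functional_map_basis.
  by rewrite entry_linear gD gZ.
(* Expanding the vectors in the basis collapses the sum over [m] vectors into the value of [g] at
   one square of a row of length [n]. *)
pose W j := \sum_l dot (h l) (b j) *: w l.
have : 0 <= g (sq_entries W).
  rewrite /g /complexification e_isq mulr0 subr0 ler0c //.
congr (0 <= _).
rewrite [sq_entries W]entries_sum g_sum.
under eq_bigr do rewrite g_sum.
transitivity (\sum_i \sum_j \sum_k \sum_l
   g (entry i j (star (w k) * w l)) * (dot (h l) (b j) * dot (b i) (h k))).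
  apply: eq_bigr => i _; apply: eq_bigr => j _.
  rewrite ffunE /= /W star_sum big_distrl /=.
  have en_sum (I : finType) (F : I -> A) :
      entry i j (\sum_k F k) = \sum_k entry i j (F k).
    apply: (big_morph (entry i j)) => [c d|].
      by rewrite -[c]scale1r entry_linear !scale1r.
    by rewrite -[X in entry _ _ X](scale0r (0 : A)) -[_ *: _]addr0 entry_linear
      scale0r; apply/ffunP => p; rewrite !ffunE if_same addr0.
  rewrite en_sum g_sum; apply: eq_bigr => k _.
  rewrite big_distrr en_sum g_sum; apply: eq_bigr => l _ /=.
  rewrite starZ -scalerAl -scalerAr scalerA -[_ *: (_ * _)]addr0 entry_linear.
  rewrite gD gZ -[X in _ + g X](_ : 0 *: entry i j 0 = _); last first.
    by apply/ffunP => p; rewrite !ffunE if_same scaler0.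
  by rewrite gZ mul0r addr0 -dotC; ring.
under eq_bigr do rewrite exchange_big.
rewrite exchange_big; apply: eq_bigr => k _.
under eq_bigr do rewrite exchange_big.
rewrite exchange_big; apply: eq_bigr => l _.
by rewrite functional_mapE.
Qed.

Lemma cp_functional_map : cp_functional functional_map = e.
Proof.
apply/funext => x; rewrite /cp_functional.
under eq_bigr do under eq_bigr do rewrite functional_map_basis.
rewrite -[RHS](Re_complexification e) [in RHS](entries_sum x) -/g g_sum.
by congr complex.Re; apply: eq_bigr => i _; rewrite g_sum.
Qed.

End Reconstruction.
End Functionals.

(** * Pure maps that maximise a given functional *)

Section PureSupport.
Variables (R : realType) (A : cstarAlgType R).
Variables (H : vectType R[i]) (dot : {dot H for @Num.conj R[i]}).
Variables (n : nat) (b : 'I_n -> H).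
Hypothesis b_basis : orthonormal_basis dot b.
Implicit Types (Phi Psi Theta : A -> 'End(H)) (y : entries A n).

Local Notation F := (cp_functional dot b).
Local Notation tau := (cp_trace dot b).
Local Notation unit_ := (unit_entries A n).
Local Notation K := (@cp_functionals R A H dot n b).

Lemma cp_functional_scale_map Psi (t : R) x :
  F (fun a => t%:C%C *: Psi a) x = t * F Psi x.
Proof.
rewrite /cp_functional -Re_realM big_distrr /=; congr complex.Re.
apply: eq_bigr => i _; rewrite big_distrr /=; apply: eq_bigr => j _.
by rewrite scale_lfunE dotZl.
Qed.

Lemma cp_functional_add_map Psi Phi x :
  F (fun a => Psi a + Phi a) x = F Psi x + F Phi x.
Proof.
rewrite /cp_functional -Re_add -big_split /=; congr complex.Re.
apply: eq_bigr => i _; rewrite -big_split /=; apply: eq_bigr => j _.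
by rewrite add_lfunE dotDl.
Qed.

(** Here [p] is the support function of the whole state space. The extreme [e] below [p] inherits
    the linear constraints common to all states: nonnegative and real on squares, 1 at the unit. So
    it comes from a completely positive map. *)
Lemma pure_support Phi y : CP A dot Phi -> tau Phi = 1 -> exists Psi,
  [/\ pure dot Psi, tau Psi = 1 & F Phi y <= F Psi y].
Proof.
move=> cpPhi Phi1.
pose S := [set f | K f /\ f unit_ = 1].
pose p x := sup [set f x | f in S].
have SPhi : S (F Phi) by split; [exists Phi|rewrite cp_functional_unit].
have p_ge f x : S f -> f x <= p x.
  move=> Sf; apply: ub_le_sup; last by exists f.
  exists (entries_norm x) => _ [_ [[Psi P <-] tP] <-].
  rewrite cp_functional_unit // in tP.
  by apply: le_trans (cp_functional_bound _ _ P) _; rewrite tP mul1r.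
have p_le x c : (forall f, S f -> f x <= c) -> p x <= c.
  move=> le; apply: ge_sup; first by exists (F Phi x), (F Phi).
  by move=> _ [f Sf <-]; exact: le.
have K_linear f : K f -> real_linear f.
  by move=> [Psi P <-]; exact: cp_functional_linear.
have K_ge0 f : K f -> 0 <= f unit_.
  by move=> [Psi P <-]; rewrite cp_functional_unit // cp_trace_ge0.
(* A functional of trace zero is bounded by zero; any other is normalised to a state. *)
have K_le f x : K f -> f x <= f unit_ * p x.
  move=> [Psi P <-]; rewrite cp_functional_unit //.
  have [t0|tn0] := eqVneq (tau Psi) 0.
    rewrite t0 mul0r; apply: le_trans (cp_functional_bound _ _ P) _.
    by rewrite t0 mul0r.
  have tp : 0 < tau Psi by rewrite lt_def tn0 cp_trace_ge0.
  rewrite -ler_pdivrMl // -cp_functional_scale_map; apply: p_ge.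
  have Q : CP A dot (fun a => ((tau Psi)^-1)%:C%C *: Psi a).
    by apply: CP_scalemap P; rewrite ler0c invr_ge0 ltW.
  split; first by exists (fun a => ((tau Psi)^-1)%:C%C *: Psi a).
  by rewrite cp_functional_scale_map cp_functional_unit // mulVf.
have face : face_support K unit_ p.
  split=> [|||f g Kf _ _ x].
  - split=> [x x'|r x r0]; apply: p_le => f Sf; have [lf lf'] := K_linear _ Sf.1.
      by rewrite lf lerD ?p_ge.
    by rewrite lf' ler_pM2l ?p_ge.
  - by apply: p_le => f [_ ->].
  - by apply: p_le => f [Kf f1]; rewrite real_linearN ?f1 //; exact: K_linear.
  - exact: K_le.
have [e [e_lin e_le e_y e_ext]] := extreme_functional K_linear K_ge0 y face.
have e_sq w : 0 <= e (sq_entries w).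
  rewrite -oppr_le0 -real_linearN //; apply: le_trans (e_le _) _.
  apply: p_le => _ [[Psi P <-] _]; rewrite real_linearN ?oppr_le0.
    exact: cp_functional_sq.
  exact: cp_functional_linear.
have e_isq w : e ('i *: sq_entries w) = 0.
  apply/le_anti/andP; split.
    apply: le_trans (e_le _) _; apply: p_le => _ [[Psi P <-] _].
    by rewrite cp_functional_isq.
  rewrite -oppr_le0 -real_linearN //; apply: le_trans (e_le _) _.
  apply: p_le => _ [[Psi P <-] _]; rewrite real_linearN ?cp_functional_isq ?oppr0 //.
  exact: cp_functional_linear.
pose Psi := functional_map dot b e.
have P : CP A dot Psi by exact: functional_map_CP.
have FE : F Psi = e by exact: cp_functional_map.
have e1 : e unit_ = 1.
  apply/le_anti/andP; split.
    by apply: le_trans (e_le _) _; case: face.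
  by rewrite -lerN2 -real_linearN // (le_trans (e_le _)) //; case: face.
exists Psi; split; last by rewrite FE; apply: le_trans e_y; exact: p_ge.
  split=> // Phi1' Theta cp1 cp2 PE.
  have K1 : K (F Phi1') by exists Phi1'.
  have K2 : K (F Theta) by exists Theta.
  have eE x : e x = F Phi1' x + F Theta x.
    rewrite -FE -cp_functional_add_map.
    by congr (cp_functional _ _ _ _); apply/funext.
  exists (F Phi1' unit_)%:C%C; first by rewrite ler0c K_ge0.
  apply: (cp_functional_scale_inj b_basis) => // x.
  by rewrite FE; exact: e_ext eE x.
by rewrite -cp_functional_unit // FE.
Qed.

End PureSupport.

(** * Closure in the BW topology by finitely many matrix coefficients *)

Section BWTopology.
Variables (R : realType) (A : cstarAlgType R).
Variables (H : vectType R[i]) (dot : {dot H for @Num.conj R[i]}).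
Implicit Types (Phi Psi : A -> 'End(H)) (S : set (A -> 'End(H))).

Lemma bw_nbhs Phi (s : seq (A * H * H)) (e : R[i]) : 0 < e ->
  nbhs (Phi : initial_topology (@bw_eval R A H dot))
    [set Psi | forall p, p \in s -> `|bw_eval dot Psi p - bw_eval dot Phi p| < e].
Proof.
move=> e0; have F0 := @nbhs_filter (initial_topology (@bw_eval R A H dot)) Phi.
elim: s => [|p s IH].
  by apply: filterS filterT => Psi _ p.
have near_p : nbhs (Phi : initial_topology (@bw_eval R A H dot))
    [set Psi | `|bw_eval dot Psi p - bw_eval dot Phi p| < e].
  have c1 := @initial_continuous _ _ (@bw_eval R A H dot) Phi.
  have c2 := @proj_continuous _ (fun _ : A * H * H => R[i]^o) p (bw_eval dot Phi).
  have := cvg_comp _ _ c1 c2; move/cvgrPdist_lt/(_ e e0).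
  move=> h; apply: (@filterS _ _ F0 _ _ _ h) => Psi /=; rewrite distrC.
  exact.
apply: filterS2 near_p IH => Psi /= hp hs q.
by rewrite inE => /predU1P[->|]; [exact: hp|exact: hs].
Qed.

(** For the converse, the sets of members of [S] close to [Phi] at finitely many points form a
    filter base whose image converges to [bw_eval dot Phi], so every neighbourhood contains one of
    them. *)
Lemma bw_closureP S Phi :
  closure (S : set (initial_topology (@bw_eval R A H dot))) Phi <->
  forall (s : seq (A * H * H)) (e : R[i]), 0 < e -> exists2 Psi, S Psi &
    forall p, p \in s -> `|bw_eval dot Psi p - bw_eval dot Phi p| < e.
Proof.
split=> [cl s e e0|approx B].
  by have [Psi [SPsi near]] := cl _ (bw_nbhs Phi s e0); exists Psi.
pose U (i : seq (A * H * H) * R[i]) := [set Psi | S Psi /\ forall p, p \in i.1 ->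
  `|bw_eval dot Psi p - bw_eval dot Phi p| < i.2].
pose G := filter_from [set i | 0 < i.2] U.
have FG : Filter G.
  apply: filter_from_filter; first by exists ([::], 1) => /=.
  move=> [s e] [s' e'] /= e0 e'0; exists (s ++ s', Num.min e e').
    by rewrite /= /Num.min; case: ifP.
  move=> Psi /= [SPsi near]; split; split=> // p ps.
    apply: lt_le_trans (near p _) _; first by rewrite mem_cat ps.
    by rewrite comparable_ge_min ?lexx // real_comparable // gtr0_real.
  apply: lt_le_trans (near p _) _; first by rewrite mem_cat ps orbT.
  by rewrite comparable_ge_min ?lexx ?orbT // real_comparable // gtr0_real.
have GP : bw_eval dot @ G --> bw_eval dot Phi.
  apply/cvg_sup => p B' [V] [[W] oW <-] Wp WB.
  apply: (filterS WB).
  have : nbhs (bw_eval dot Phi p : R[i]^o) W by exact: open_nbhs_nbhs.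
  move=> /nbhs_ballP[e /= e0 eW]; exists ([:: p], e) => //= Psi [_ near].
  by apply: eW; rewrite /ball /= distrC near // mem_head.
rewrite nbhsE => -[_ [[V oV <-] VPhi] VB].
have [[s e] /= e0 sub] : G (bw_eval dot @^-1` V).
  by apply: GP; exact: open_nbhs_nbhs.
have [Psi SPsi near] := approx s e e0.
by exists Psi; split=> //; apply: VB; apply: sub.
Qed.

End BWTopology.

(** * Approximation of contractive completely positive maps from the C*-convex hull *)

Lemma norm_real_complex (R : realType) (r : R) : `|r%:C%C| = `|r|%:C%C.
Proof. by rewrite normc_def /= expr0n addr0 sqrtr_sqr. Qed.

Lemma norm_le_Re (R : realType) (z : R[i]) (d : R) :
  `|complex.Re z| <= d -> `|complex.Re ('i * z)| <= d -> `|z| <= (d + d)%:C%C.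
Proof.
move=> d1 d2; rewrite [z]complex_ReE; apply: le_trans (ler_normB _ _) _.
by rewrite normrM normCi mul1r !norm_real_complex rmorphD lerD ?lecR.
Qed.

Lemma real_linear_sum (R : realType) (V : lmodType R[i]) (f : V -> R)
    (I : Type) (s : seq I) (P : pred I) (c : I -> R) (y : I -> V) :
  real_linear f -> f (\sum_(i <- s | P i) (c i)%:C%C *: y i) =
  \sum_(i <- s | P i) c i * f (y i).
Proof.
move=> [fD fZ]; elim/big_rec2: _ => [|i a v _ <-]; last by rewrite fD fZ.
by rewrite -(scale0r (0 : V)) (fZ 0) mul0r.
Qed.

Section Approximation.
Variables (R : realType) (A : cstarAlgType R).
Variables (H : vectType R[i]) (dot : {dot H for @Num.conj R[i]}).
Implicit Types (Phi Psi Theta : A -> 'End(H)) (p : A * H * H).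

Section Basis.
Variables (n : nat) (b : 'I_n -> H).
Hypothesis b_basis : orthonormal_basis dot b.

Local Notation F := (cp_functional dot b).
Local Notation tau := (cp_trace dot b).

Definition point_entries p : entries A n :=
  [ffun ij => (dot p.1.2 (b ij.2) * dot (b ij.1) p.2) *: p.1.1].

Lemma cp_functional_point Psi p (c : R[i]) : CP A dot Psi ->
  F Psi (c *: point_entries p) = complex.Re (c * bw_eval dot Psi p).
Proof.
move=> P; have [_ bE] := b_basis; congr complex.Re.
case: p => -[a h] k; rewrite /bw_eval /=.
rewrite [in RHS](bE h) lfun_sum dot_suml.
under [in RHS]eq_bigr do rewrite [X in dot _ X](bE k) dot_sumr.
rewrite exchange_big big_distrr; apply: eq_bigr => j _ /=.
rewrite big_distrr; apply: eq_bigr => i _ /=.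
rewrite !ffunE /= !(CP_scale _ _ P) !scale_lfunE lfunZ !dotZl dotZr -dotC.
by ring.
Qed.

Lemma cp_functional_sum_map k (G : 'I_k -> A -> 'End(H)) x :
  F (fun a => \sum_i G i a) x = \sum_i F (G i) x.
Proof.
rewrite /cp_functional -Re_sum [in RHS]exchange_big; congr complex.Re.
apply: eq_bigr => i _; rewrite [RHS]exchange_big; apply: eq_bigr => j _.
by rewrite sum_lfunE dot_suml.
Qed.

Lemma cp_functional_abs Psi x : CP A dot Psi ->
  `|F Psi x| <= tau Psi * entries_norm x.
Proof.
move=> P; rewrite ler_norml cp_functional_bound // andbT lerNl.
rewrite -real_linearN; last exact: cp_functional_linear.
have -> : entries_norm x = entries_norm (- x).
  congr complex.Re; apply: eq_bigr => i _; apply: eq_bigr => j _.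
  by rewrite ffunE cnormN.
exact: cp_functional_bound.
Qed.

(** Applies [greedy_sum] to the errors of normalised pure maps against the normalised [Phi'];
    [pure_support] supplies the obtuse angle. *)
Lemma sum_of_pure_approx Phi (L : finType) (q : L -> A * H * H) (d : R) :
    CP A dot Phi -> 0 < tau Phi -> 0 < d ->
  exists k (c : R) (S : 'I_k -> A -> 'End(H)),
    [/\ 0 <= c, forall i, pure dot (S i) &
      forall l, `|bw_eval dot (fun a => \sum_i c%:C%C *: S i a) (q l)
                  - bw_eval dot Phi (q l)| <= (d + d)%:C%C].
Proof.
move=> P t0 d0; set t := tau Phi in t0 *.
(* The factors [1] and ['i] test the real and the imaginary part of each value. *)
pose Y (l : L * bool) :=
  (if l.2 then 1 else 'i : R[i]) *: point_entries (q l.1).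
pose Phi' a := (t^-1)%:C%C *: Phi a.
have P' : CP A dot Phi' by apply: CP_scalemap P; rewrite ler0c invr_ge0 ltW.
have t1 : tau Phi' = 1.
  by rewrite -cp_functional_unit // cp_functional_scale_map
     cp_functional_unit // mulVf // gt_eqF.
pose E := [set Psi : A -> 'End(H) | pure dot Psi /\ tau Psi = 1].
pose v Psi l := F Psi (Y l) - F Phi' (Y l).
pose M := \sum_l (entries_norm (Y l) *+ 2) ^+ 2.
have obt (c : L * bool -> R) : exists2 Psi, E Psi & \sum_l c l * v Psi l <= 0.
  have [Psi [pPsi tPsi le]] :=
    pure_support b_basis (\sum_l (- c l)%:C%C *: Y l) P' t1.
  exists Psi => //; move: le.
  rewrite !real_linear_sum;
    [|exact: cp_functional_linear pPsi.1|exact: cp_functional_linear].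
  under eq_bigr do rewrite mulNr; under [leRHS]eq_bigr do rewrite mulNr.
  rewrite !sumrN lerN2 -subr_le0 -sumrB.
  by under eq_bigr do rewrite -mulrBr.
have bnd Psi : E Psi -> \sum_l v Psi l ^+ 2 <= M.
  move=> [[Q _] tPsi]; apply: ler_sum => l _.
  rewrite -real_normK ?num_real // ler_pXn2r ?nnegrE //; last first.
    rewrite mulrn_wge0 //; apply/Re_ge0/sumr_ge0 => i _; apply/sumr_ge0 => j _.
    exact: cnorm_ge0.
  apply: le_trans (ler_normB _ _) _; rewrite mulr2n lerD //.
    by apply: le_trans (cp_functional_abs _ Q) _; rewrite tPsi mul1r.
  by apply: le_trans (cp_functional_abs _ P') _; rewrite t1 mul1r.
have M0 : 0 <= M by apply: sumr_ge0 => l _; rewrite sqr_ge0.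
have x0 : 0 <= t ^+ 2 * M / d ^+ 2.
  by apply: divr_ge0; [apply: mulr_ge0 => //|]; exact: sqr_ge0.
(* Large enough for [t ^+ 2 * M / k <= d ^+ 2]; the successor keeps [k] positive. *)
pose k := (Num.bound (t ^+ 2 * M / d ^+ 2)).+1.
have kP : t ^+ 2 * M / d ^+ 2 <= k%:R.
  by rewrite (le_trans (ltW (archi_boundP x0))) // ler_nat.
have k0 : 0 < k%:R :> R by rewrite ltr0n.
have [S SE SM] := greedy_sum obt bnd k.
(* An average of [k] maps, with the normalisation of [Phi] undone. *)
pose c := t / k%:R.
have c0 : 0 <= c by rewrite divr_ge0 // ltW.
exists k, c, S; split=> // [i|l]; first exact: (SE i).1.
pose Xi a := \sum_i c%:C%C *: S i a.
have cpX : CP A dot Xi.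
  by apply: CP_summap => i _; apply: CP_scalemap; [rewrite ler0c|case: (SE i) => -[]].
have near lb : `|F Xi (Y lb) - F Phi (Y lb)| <= d.
  have -> : F Xi (Y lb) - F Phi (Y lb) = c * \sum_i v (S i) lb.
    rewrite cp_functional_sum_map /v sumrB sumr_const card_ord mulrBr.
    rewrite big_distrr /=; congr (_ - _).
      by apply: eq_bigr => i _; rewrite cp_functional_scale_map.
    rewrite cp_functional_scale_map -mulr_natr /c.
    by field; rewrite !gt_eqF.
  rewrite -(ler_pXn2r (ltn0Sn 1)) ?nnegrE ?normr_ge0 ?(ltW d0) //.
  rewrite real_normK ?num_real // exprMn.
  have le1 : (\sum_i v (S i) lb) ^+ 2 <= M *+ k.
    apply: le_trans SM; rewrite (bigD1 lb) //= lerDl.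
    by apply: sumr_ge0 => l' _; rewrite sqr_ge0.
  apply: le_trans (ler_wpM2l (sqr_ge0 c) le1) _.
  rewrite -mulr_natr /c.
  have -> : (t / k%:R) ^+ 2 * (M * k%:R) = t ^+ 2 * M / k%:R.
    by field; rewrite gt_eqF.
  by rewrite ler_pdivrMr // [leRHS]mulrC -ler_pdivrMr ?exprn_gt0.
have ReB (x y : R[i]) : complex.Re (x - y) = complex.Re x - complex.Re y.
  by case: x => ? ?; case: y.
apply: norm_le_Re.
  by have := near (l, true); rewrite /Y /= !cp_functional_point // !mul1r ReB.
by have := near (l, false); rewrite /Y /= !cp_functional_point // mulrBr ReB.
Qed.

Lemma op_entry_bound (D : 'End(H)) (d : R[i]) h :
  (forall i j, `|dot (D (b j)) (b i)| <= d) ->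
  `|dot (D h) h| <= (n * n)%:R * d * dot h h.
Proof.
move=> Dd; have [bo bE] := b_basis.
have hb i : `|dot h (b i)| <= hnorm dot h.
  have [+ _] := CauchySchwarz_sqrt dot h (b i).
  by rewrite bo eqxx sqrtC1 mulr1.
have -> : dot (D h) h =
    \sum_j \sum_i dot h (b j) * (dot h (b i))^* * dot (D (b j)) (b i).
  rewrite [in LHS](bE h) lfun_sum dot_suml; apply: eq_bigr => j _.
  rewrite -(bE h) [X in dot _ X](bE h) dot_sumr; apply: eq_bigr => i _.
  by rewrite lfunZ dotZl dotZr mulrA.
apply: le_trans (ler_norm_sum _ _ _) _.
have -> : (n * n)%:R * d * dot h h = \sum_(j < n) \sum_(i < n) dot h h * d.
  by rewrite !sumr_const !card_ord -mulrnA -[RHS]mulr_natl; ring.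
apply: ler_sum => j _; apply: le_trans (ler_norm_sum _ _ _) _.
apply: ler_sum => i _; rewrite !normrM norm_conjC.
have hh : hnorm dot h * hnorm dot h = dot h h by rewrite -expr2 sqrtCK.
by rewrite -hh ler_pM ?mulr_ge0 // ler_pM.
Qed.

End Basis.

Lemma cstar_extreme_zero : cstar_extreme A dot (fun=> 0).
Proof.
by apply: pure_projection_extreme; [exact: pure_zero|rewrite comp_lfun0l].
Qed.

(** The operator coefficients are [sqrtC c] times those of [pure_factor]; the positive defect from
    the identity is factored as [T0^* T0] and attached to the zero map. *)
Lemma pure_sum_hull k (c : R) (S : 'I_k -> A -> 'End(H)) : 0 <= c ->
    (forall i, pure dot (S i)) ->
    (forall h, dot ((\sum_i c%:C%C *: S i 1) h) h <= dot h h) ->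
  cstar_hull dot (cstar_extreme A dot) (fun a => \sum_i c%:C%C *: S i a).
Proof.
move=> c0 Sp S1.
have ex i : exists TP : 'End(H) * (A -> 'End(H)),
    [/\ cstar_extreme A dot TP.2, (adj dot TP.1 \o TP.1)%VF = S i 1 &
      forall a, S i a = Ad dot TP.1 (TP.2 a)].
  by have [T [Phi ?]] := pure_factor (Sp i); exists (T, Phi).
have [TP TPP] := choice ex.
have [T0 T0E] : exists T0, (adj dot T0 \o T0)%VF = \1%VF - \sum_i c%:C%C *: S i 1.
  apply: op_pos_factor => h.
  by rewrite add_lfunE opp_lfunE id_lfunE dotBl subr_ge0.
pose s : R[i] := sqrtC c%:C%C.
have s0 : 0 <= s by rewrite sqrtC_ge0 ler0c.
have sC : s^* = s by apply/CrealP/ger0_real.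
have ss : s * s = c%:C%C by rewrite -expr2 sqrtCK.
exists k.+1, (fun i => if unlift ord0 i is Some j then s *: (TP j).1 else T0),
  (fun i => if unlift ord0 i is Some j then (TP j).2 else fun=> 0).
split; first by move=> i; case: unliftP => [j _|_];
  [case: (TPP j)|exact: cstar_extreme_zero].
split=> // [|a]; rewrite big_ord_recl unlift_none.
  rewrite T0E -[RHS](subrK (\sum_i c%:C%C *: S i 1)); congr (_ + _).
  apply: eq_bigr => i _; rewrite liftK; case: (TPP i) => _ <- _.
  by rewrite adjZ sC -comp_lfunZl -comp_lfunZr scalerA ss.
rewrite Ad0 add0r; apply: eq_bigr => i _; rewrite liftK AdZl sC ss.
by case: (TPP i) => _ _ ->.
Qed.

Lemma CCP_unit_le Phi : CCP A dot Phi -> forall h, dot (Phi 1 h) h <= dot h h.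
Proof. by move=> [P /(CP_contractive P)]. Qed.

(** At 1, each term [T_j^* Phi_j(1) T_j] is at most [T_j^* T_j], and these sum to the identity. *)
Lemma cstar_comb_CCP m (T : 'I_m -> 'End(H)) (Phi_ : 'I_m -> A -> 'End(H)) Phi :
  (forall j, CCP A dot (Phi_ j)) -> cstar_comb dot T Phi_ Phi -> CCP A dot Phi.
Proof.
move=> ccp [_ T1 comb].
have P : CP A dot Phi.
  have -> : Phi = fun a => \sum_j Ad dot (T j) (Phi_ j a) by apply/funext.
  by apply: CP_summap => j _; apply: CP_Ad; case: (ccp j).
split=> //; apply/(CP_contractive P) => h.
rewrite comb sum_lfunE dot_suml -[X in _ <= dot X _]id_lfunE -T1 sum_lfunE.
rewrite dot_suml; apply: ler_sum => j _.
rewrite AdE comp_lfunE -[X in _ <= dot _ X]id_lfunE id_lfunE.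
by rewrite [leRHS]adjP adjK; exact: CCP_unit_le.
Qed.

Lemma hull_approx Phi (s : seq (A * H * H)) (e : R[i]) :
    CCP A dot Phi -> 0 < e ->
  exists2 Psi, cstar_hull dot (cstar_extreme A dot) Psi &
    forall p, p \in s -> `|bw_eval dot Psi p - bw_eval dot Phi p| < e.
Proof.
move=> ccp e0; have P := ccp.1.
have [n [b b_basis]] := orthonormal_basis_ex dot; have [bo bE] := b_basis.
have [t0|tn0] := eqVneq (cp_trace dot b Phi) 0.
  have Phi0 a : Phi a = 0.
    apply: (CP_eq0 P); apply: (lfun_basis_eq b_basis) => i j.
    rewrite zero_lfunE dot0l; apply/eqP; rewrite -normr_le0.
    by have := cp_entry_bound b 1 i j P; rewrite t0 mulr0.
  exists Phi => [|p _]; last by rewrite subrr normr0.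
  exists 1%N, (fun=> \1%VF), (fun=> fun=> 0); split.
    by move=> _; exact: cstar_extreme_zero.
  split=> // [|a]; rewrite big_ord1 ?adj1 ?comp_lfun1l //.
  by rewrite Ad0.
have tp : 0 < cp_trace dot b Phi by rewrite lt_def tn0 cp_trace_ge0.
have eE := ge0_ReE (ltW e0); set r := complex.Re e in eE.
have r0 : 0 < r by rewrite eE (ltcR 0) in e0.
pose B : R := complex.Re (\sum_(p <- s) `|bw_eval dot Phi p|).
have B0 : 0 <= B by apply/Re_ge0/sumr_ge0 => p _.
have Bp p : p \in s -> `|bw_eval dot Phi p| <= B%:C%C.
  move=> ps; rewrite /B -ge0_ReE ?sumr_ge0 // (big_rem p) //= lerDl.
  exact: sumr_ge0.
(* Chosen so that [(d + d) + eta * B], the error after rescaling, equals [r / 2]. *)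
pose d := r / (4 * (1 + (n * n)%:R * B)).
have den0 : 0 < 1 + (n * n)%:R * B by rewrite ltr_wpDr ?mulr_ge0.
have d0 : 0 < d by rewrite divr_gt0 // mulr_gt0.
(* Besides the points of [s], the matrix entries of the value at 1 are approximated; this bounds
   [Xi 1] by [1 + eta]. *)
pose q (l : seq_sub s + 'I_n * 'I_n) : A * H * H :=
  match l with inl p => val p | inr ij => (1, b ij.2, b ij.1) end.
have [k [c [S [c0 Sp near]]]] := sum_of_pure_approx b_basis q P tp d0.
pose Xi a := \sum_i c%:C%C *: S i a.
pose eta := (n * n)%:R * (d + d).
have eta0 : 0 <= eta by rewrite mulr_ge0 // addr_ge0 // ltW.
have cpX : CP A dot Xi.
  by apply: CP_summap => i _; apply: CP_scalemap; [rewrite ler0c|case: (Sp i)].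
have Xi1 h : dot (Xi 1 h) h <= (1 + eta)%:C%C * dot h h.
  have le : `|dot ((Xi 1 - Phi 1) h) h| <= eta%:C%C * dot h h.
    rewrite /eta rmorphM rmorph_nat; apply: (op_entry_bound b_basis) => i j.
    by rewrite add_lfunE opp_lfunE dotBl; exact: (near (inr (i, j))).
  rewrite -[leLHS]ger0_norm; last exact: CP_unit_pos.
  have -> : dot (Xi 1 h) h = dot (Phi 1 h) h + dot ((Xi 1 - Phi 1) h) h.
    by rewrite add_lfunE opp_lfunE dotBl addrC subrK.
  apply: le_trans (ler_normD _ _) _.
  rewrite rmorphD rmorph1 mulrDl mul1r lerD // ger0_norm ?CCP_unit_le //.
  exact: CP_unit_pos.
have eta1 : 0 < 1 + eta by rewrite ltr_wpDr.
pose x := (1 + eta)^-1.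
have x0 : 0 <= x by rewrite invr_ge0 ltW.
have xE a : \sum_i (x * c)%:C%C *: S i a = x%:C%C *: Xi a.
  by rewrite /Xi scaler_sumr; apply: eq_bigr => i _; rewrite scalerA -rmorphM.
exists (fun a => \sum_i (x * c)%:C%C *: S i a).
  apply: pure_sum_hull => // [|h]; first by rewrite mulr_ge0.
  rewrite xE scale_lfunE dotZl.
  apply: le_trans (ler_wpM2l _ (Xi1 h)) _; first by rewrite ler0c.
  by rewrite mulrA -rmorphM /= mulVf ?gt_eqF // mul1r.
move=> p ps; rewrite /bw_eval xE scale_lfunE dotZl -/(bw_eval dot Xi p).
rewrite -/(bw_eval dot Phi p).
(* Splits the error into that of the approximation and that of rescaling by [x], where
   [1 - x <= eta]. *)
have -> : x%:C%C * bw_eval dot Xi p - bw_eval dot Phi p =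
    x%:C%C * (bw_eval dot Xi p - bw_eval dot Phi p)
    - (1 - x)%:C%C * bw_eval dot Phi p.
  by rewrite rmorphB rmorph1; ring.
have x1 : x <= 1 by rewrite invf_le1 // lerDl.
have x1' : 0 <= 1 - x by rewrite subr_ge0.
have xeta : 1 - x <= eta.
  have -> : 1 - x = eta * x by rewrite /x; field; rewrite gt_eqF.
  by rewrite ler_piMr.
have bnd : (d + d) + eta * B < r.
  have -> : (d + d) + eta * B = r / 2.
    rewrite /eta /d; move: den0; move: (n * n)%:R (B) => N B' den0'.
    by field; rewrite gt_eqF.
  by rewrite ltr_pdivrMr // mulr_natr mulr2n ltrDl.
rewrite eE; apply: le_lt_trans (_ : ((d + d) + eta * B)%:C%C < _); last by rewrite ltcR.
apply: le_trans (ler_normB _ _) _; rewrite !normrM !norm_real_complex.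
rewrite (ger0_norm x0) (ger0_norm x1') [leRHS]rmorphD; apply: lerD.
  have := near (inl (SeqSub ps)); rewrite /q /= => le.
  apply: le_trans le; rewrite -[leRHS]mul1r ler_wpM2r //.
  by rewrite (lecR x 1).
rewrite [leRHS]rmorphM; apply: ler_pM; [by rewrite ler0c|exact: normr_ge0| |exact: Bp].
by rewrite lecR.
Qed.

End Approximation.

(** * Density of the hull, and stability of contractivity under BW limits *)

Theorem theorem4p16 (R : realType) (A : cstarAlgType R)
    (H : vectType R[i]) (dot : {dot H for @Num.conj R[i]}) :
  CCP A dot = bw_closure_CP dot (cstar_hull dot (cstar_extreme A dot)).
Proof.
apply/seteqP; split=> Phi.
  move=> ccp; split; first exact: ccp.1.
  by apply/bw_closureP => s e e0; exact: hull_approx.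
(* Contractivity is the bound on [dot (Phi 1 h) h], which passes to the limit by approximation at
   the single point [(1, h, h)]. *)
move=> [P /bw_closureP cl]; split=> //; apply/(CP_contractive P) => h.
have P1 := CP_unit_pos P h; have h0 := dnorm_ge0 dot h.
rewrite (ge0_ReE P1) (ge0_ReE h0) lecR; apply/ler_addgt0Pr => e e0.
have e0' : 0 < e%:C%C by rewrite (ltcR 0).
have [Psi [n [T [Phi_ [ext comb]]]]] := cl [:: (1, h, h)] _ e0'.
move=> /(_ _ (mem_head _ _)); rewrite /bw_eval /= => lt.
have ccp : CCP A dot Psi by apply: cstar_comb_CCP comb => j; case: (ext j).
have le := CCP_unit_le ccp h.
rewrite -lecR rmorphD -[X in X <= _](ge0_ReE P1) -[X in _ <= X + _](ge0_ReE h0).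
rewrite -[leLHS](ger0_norm P1).
have -> : dot (Phi 1 h) h =
    dot (Psi 1 h) h - (dot (Psi 1 h) h - dot (Phi 1 h) h) by ring.
apply: le_trans (ler_normB _ _) _; apply: lerD; last exact: ltW.
by rewrite (ger0_norm (CP_unit_pos ccp.1 h)).
Qed.
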